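(* Let $A=C^*(\Gamma)$ be the group C*-algebra of the infinite dihedral group $\Gamma=\mathbf{Z}\times_\sigma\mathbf{Z}_2$, and let $\mathbf{w}_0,\mathbf{w}_1,\mathbf{w}_2$ be the even Fredholm modules over $A$ defined in the context. Their pairings with K-theory are: $$\langle ch_*(\mathbf{w}_0),[1]\rangle=1,\quad \langle ch_*(\mathbf{w}_0),[\tfrac12(1+e)]\rangle=1,\quad \langle ch_*(\mathbf{w}_0),[\tfrac12(1+Se)]\rangle=1,$$ $$\langle ch_*(\mathbf{w}_1),[1]\rangle=0,\quad \langle ch_*(\mathbf{w}_1),[\tfrac12(1+e)]\rangle=1,\quad \langle ch_*(\mathbf{w}_1),[\tfrac12(1+Se)]\rangle=0,$$ $$\langle ch_*(\mathbf{w}_2),[1]\rangle=0,\quad \langle ch_*(\mathbf{w}_2),[\tfrac12(1+e)]\rangle=0,\quad \langle ch_*(\mathbf{w}_2),[\tfrac12(1+Se)]\rangle=1.$$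
   Context: $A$ is generated by unitaries $S,e$ with $e=e^*$, $e^2=1$, $eSe=S^*=S^{-1}$. An even Fredholm module over $A$ is $(H,\pi,F,\gamma)$ where $\pi$ is a *-representation of $A$ on a Hilbert space $H$, $F=F^*$, $F^2=1$, $[F,\pi(a)]$ is compact for all $a\in A$, and $\gamma=\gamma^*$, $\gamma^2=1$, $[\gamma,\pi(a)]=0$, $F\gamma=-\gamma F$. The pairing $\langle ch_*(\cdot),\cdot\rangle$ is Connes' pairing of the even Chern character (in even periodic cyclic cohomology) with $K_0$; for a projection $P$ in $A$ (for which the commutators are sufficiently summable) it is $$\langle ch_*(H,\pi,F,\gamma),[P]\rangle=\lim_{n\to\infty}(-1)^n\,\mathrm{Tr}\big(\gamma\,\pi(P)[F,\pi(P)]^{2n}\big).$$ The modules: $\mathbf{w}_0=\left(\mathbf{C}^2,\ \phi\oplus 0,\ \begin{pmatrix}0&1\\1&0\end{pmatrix},\ \begin{pmatrix}1&0\\0&-1\end{pmatrix}\right)$, where $\phi:A\to\mathbf{C}$ is the *-homomorphism with $\phi(S)=\phi(e)=1$. $\mathbf{w}_1=(H,\pi_1,F_1,\gamma)$, where $H=l^2(\mathbf{Z})\oplus l^2(\mathbf{Z})$; $A$ acts on $l^2(\mathbf{Z})$ (orthonormal basis $\{e_n\}_{n\in\mathbf{Z}}$) by $Se_n=e_{n+1}$, $e\,e_n=e_{-n}$; $\pi_1(S)=\begin{pmatrix}S&0\\0&S\end{pmatrix}$, $\pi_1(e)=\begin{pmatrix}e&0\\0&-e\end{pmatrix}$; $F_1=\begin{pmatrix}0&iF\\-iF&0\end{pmatrix}$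 with $Fe_n=\mathrm{sign}(n)e_n$, where $\mathrm{sign}(n)=1$ for $n\ge 0$ and $-1$ for $n<0$; $\gamma=\begin{pmatrix}1&0\\0&-1\end{pmatrix}$. $\mathbf{w}_2=\alpha_{-1}^*(\mathbf{w}_1)=(H,\pi_1\circ\alpha_{-1},F_1,\gamma)$, where $\alpha_{-1}$ is the automorphism of $A$ with $\alpha_{-1}(S)=S$, $\alpha_{-1}(e)=S^{-1}e$. *)

(* Defs.v *)
From HB Require Import structures.
From mathcomp Require Import all_boot all_order all_algebra finmap complex ring lra.
From mathcomp Require Import sesquilinear.
From mathcomp Require Import all_classical reals topology normedtype sequences.
From mathcomp.analysis.showcase Require Import summability.

Set Implicit Arguments.
Unset Strict Implicit.
Unset Printing Implicit Defensive.

Import Order.TTheory GRing.Theory Num.Theory.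
Import numFieldNormedType.Exports.

Local Open Scope classical_set_scope.
Local Open Scope ring_scope.
Local Open Scope complex_scope.

HB.instance Definition _ (R : realType) := GRing.ComAlgebra.copy R[i] R[i]^o.
HB.instance Definition _ (R : realType) := NormedModule.copy R[i] R[i]^o.

Section complex_complete.
Variable R : realType.

Lemma complex_cauchy_cvg (F : set_system R[i]) :
  ProperFilter F -> cauchy F -> cvg F.
Proof.
move=> FF /cauchyP Fc; apply/cvg_ex.
have part (h : R[i] -> R) : (forall x y, `|h x - h y|%:C <= `|x - y|) ->
    exists a : R, h @ F --> a.
  move=> hle; suff hF : cvg (h @ F) by exists (lim (h @ F)).
  apply: cauchy_cvg; apply/cauchyP => e e0.
  have e0' : 0 < e%:C by rewrite ltcR.
  have [x Fx] := Fc _ e0'; exists (h x).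
  change (F (h @^-1` ball (h x) e)); apply: filterS Fx => y.
  rewrite -!ball_normE /= => xy.
  by rewrite -ltcR; apply: le_lt_trans (hle _ _) xy.
have Rle (x y : R[i]) : `|complex.Re x - complex.Re y|%:C <= `|x - y|.
  by rewrite -raddfB normc_ge_Re.
have Ile (x y : R[i]) : `|complex.Im x - complex.Im y|%:C <= `|x - y|.
  rewrite -raddfB -normrN -[leRHS]mulr1 -(_ : `|'i : R[i]| = 1); last first.
    by rewrite normc_def/= expr0n expr1n add0r sqrtr1.
  by rewrite -ReiNIm -normrM normc_ge_Re.
have [a Fa] := part _ Rle; have [b Fb] := part _ Ile.
exists (a +i* b); apply/cvgrPdist_lt => e e0.
have er : e = (complex.Re e)%:C by rewrite RRe_real ?gtr0_real.
have e2 : 0 < complex.Re e / 2 by rewrite divr_gt0// -ltcR -er.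
move/cvgrPdist_lt : Fa => /(_ _ e2) Fa; move/cvgrPdist_lt : Fb => /(_ _ e2) Fb.
have dec z : a +i* b - z = (a - complex.Re z)%:C + 'i * (b - complex.Im z)%:C.
  by case: z => c d; rewrite [RHS]complexE; simpc.
near=> z; rewrite dec.
rewrite (le_lt_trans (ler_normD _ _))// normrM.
have -> : `|'i : R[i]| = 1 by rewrite normc_def/= expr0n expr1n add0r sqrtr1.
rewrite mul1r !normc_def/= expr0n/= !addr0 !sqrtr_sqr er -rmorphD/= ltcR.
by rewrite [ltRHS]splitr ltrD//; near: z.
Unshelve. all: by end_near. Qed.

HB.instance Definition _ := Uniform_isComplete.Build R[i] complex_cauchy_cvg.
End complex_complete.

(* The inner product is linear in its first argument and conjugate-linear in
   the second; norms take their values in R[i], as for any normedModType. *)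
HB.mixin Record NormedModule_isHilbert (R : realType) H
    of CompleteNormedModule R[i] H := {
  inner : {dot H for @Num.conj R[i]};
  inner_norm : forall x : H, `|x| ^+ 2 = inner x x }.

#[short(type="hilbertType")]
HB.structure Definition Hilbert (R : realType) :=
  {H of NormedModule_isHilbert R H & CompleteNormedModule R[i] H}.

Section dot_norm.
Variables (R : realType) (V : lmodType R[i]) (d : {dot V for @Num.conj R[i]}).

Lemma dot_ge0 x : 0 <= d x x.
Proof.
have [->|x0] := eqVneq x 0; first by rewrite linear0r.
exact/ltW/neq0_dnorm_gt0.
Qed.

Lemma dotC x y : d x y = (d y x)^*%R.
Proof. by rewrite hermC expr0 mul1r. Qed.

Lemma dot_CS x y : `|d x y| ^+ 2 <= d x x * d y y.
Proof.
have [->|y0] := eqVneq y 0; first by rewrite !linear0r normr0 expr0n mulr0.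
have yy : 0 < d y y by exact: neq0_dnorm_gt0.
have := dot_ge0 (d y y *: x - d x y *: y).
rewrite linearBr/= linearZr/= linearZr/= linearBl linearBl/= !linearZl_LR/=.
rewrite -(dotC y x).
have -> : (d y y)^*%R = d y y by rewrite -dotC.
move=> h; rewrite -(ler_pM2l yy) normCK -dotC -subr_ge0.
by apply: le_trans h _; rewrite le_eqVlt; apply/orP; left; apply/eqP; ring.
Qed.

Definition dot_norm x := sqrtC (d x x).

Lemma dot_normK x : dot_norm x ^+ 2 = d x x.
Proof. exact: sqrtCK. Qed.

Lemma dot_norm_ge0 x : 0 <= dot_norm x.
Proof. by rewrite sqrtC_ge0 dot_ge0. Qed.

Lemma dot_normD x y : dot_norm (x + y) <= dot_norm x + dot_norm y.
Proof.
have xy0 : 0 <= dot_norm x + dot_norm y by rewrite addr_ge0 ?dot_norm_ge0.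
rewrite -(@ler_pXn2r _ 2%N)// ?nnegrE ?dot_norm_ge0//.
rewrite sqrrD !dot_normK linearD/= !linearDl/= (dotC y x).
have h : d x y + (d x y)^*%R <= dot_norm x * dot_norm y *+ 2.
  have := (leif_Re_Creal (d x y)).1; rewrite ReE ler_pdivrMr// mulr_natr.
  move=> /le_trans; apply; rewrite lerMn2r/=.
  rewrite -(@ler_pXn2r _ 2%N)// ?nnegrE ?mulr_ge0 ?dot_norm_ge0//.
  by rewrite exprMn !dot_normK dot_CS.
have -> : d x x + (d x y)^*%R + (d x y + d y y) = d x x + (d x y + (d x y)^*%R) + d y y by ring.
by rewrite lerD2r lerD2l.
Qed.

Lemma dot_normZ a x : dot_norm (a *: x) = `|a| * dot_norm x.
Proof.
rewrite /dot_norm linearZ/= linearZl_LR/= mulrA -normCKC sqrtCM ?nnegrE ?dot_ge0 ?exprn_ge0//.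
by rewrite sqrCK.
Qed.

Lemma dot_norm_eq0 x : dot_norm x = 0 -> x = 0.
Proof.
move=> /eqP; rewrite sqrtC_eq0; apply: contraTeq => /neq0_dnorm_gt0-/(_ _ d).
by move=> /gt_eqF ->.
Qed.

End dot_norm.

Definition complex_dot (R : realType) (x y : R[i]) : R[i] := x * y^*%R.

Section complex_dot.
Variable R : realType.

Lemma complex_dot_bilinear :
  bilinear_for *%R (@Num.conj R[i] \; *%R) (@complex_dot R).
Proof.
split => u a x y; rewrite /complex_dot/=; first by rewrite mulrDl mulrA.
by rewrite rmorphD rmorphM /= mulrDr mulrCA.
Qed.

HB.instance Definition _ := bilinear_isBilinear.Build R[i] R[i] R[i] R[i]
  *%R (@Num.conj R[i] \; *%R) (@complex_dot R) complex_dot_bilinear.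

Lemma complex_dot_herm (x y : R[i]) :
  complex_dot x y = (-1) ^+ false * (complex_dot y x)^*%R.
Proof. by rewrite expr0 mul1r /complex_dot rmorphM /= conjCK mulrC. Qed.

HB.instance Definition _ := isHermitianSesquilinear.Build R[i] R[i] false
  (@Num.conj R[i]) (@complex_dot R) complex_dot_herm.

Lemma complex_dot_gt0 (x : R[i]) : x != 0 -> 0 < complex_dot x x.
Proof. by move=> x0; rewrite /complex_dot -normCK exprn_gt0 ?normr_gt0. Qed.

HB.instance Definition _ := isDotProduct.Build R[i] R[i]
  (@complex_dot R) complex_dot_gt0.

Lemma complex_dot_norm (x : R[i]) : `|x| ^+ 2 = complex_dot x x.
Proof. exact: normCK. Qed.

HB.instance Definition _ := NormedModule_isHilbert.Build R R[i] complex_dot_norm.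

End complex_dot.

(* Orthogonal direct sum. The alias hides the sup norm that the product of two
   normed modules carries by default. *)
Definition hsum (R : realType) (H K : hilbertType R) : Type := (H * K)%type.

Section hsum.
Variables (R : realType) (H K : hilbertType R).
Implicit Types x y z : hsum H K.

HB.instance Definition _ := GRing.Lmodule.copy (hsum H K) (H * K)%type.

Definition hsum_dot x y : R[i] := inner x.1 y.1 + inner x.2 y.2.

Lemma hsum_dot_bilinear :
  bilinear_for *%R (@Num.conj R[i] \; *%R) hsum_dot.
Proof.
split => u a x y; rewrite /hsum_dot/= ?linearDl ?linearD/= ?linearZl_LR ?linearZ/=.
  by rewrite mulrDr addrACA.
by rewrite mulrDr addrACA.
Qed.

HB.instance Definition _ := bilinear_isBilinear.Build R[i] (hsum H K) (hsum H K)
  R[i] *%R (@Num.conj R[i] \; *%R) hsum_dot hsum_dot_bilinear.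

Lemma hsum_dot_herm x y : hsum_dot x y = (-1) ^+ false * (hsum_dot y x)^*%R.
Proof.
by rewrite expr0 mul1r /hsum_dot rmorphD /= (dotC inner x.1) (dotC inner x.2).
Qed.

HB.instance Definition _ := isHermitianSesquilinear.Build R[i] (hsum H K) false
  (@Num.conj R[i]) hsum_dot hsum_dot_herm.

Lemma hsum_dot_gt0 x : x != 0 -> 0 < hsum_dot x x.
Proof.
move=> x0; rewrite lt_def addr_ge0 ?dot_ge0// andbT.
apply: contra_neq x0 => /eqP; rewrite paddr_eq0 ?dot_ge0//.
rewrite -!inner_norm !expf_eq0/= !normr_eq0 => /andP[/eqP x1 /eqP x2].
by rewrite [LHS]surjective_pairing x1 x2.
Qed.

HB.instance Definition _ := isDotProduct.Build R[i] (hsum H K)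
  hsum_dot hsum_dot_gt0.

HB.instance Definition _ := Lmodule_isNormed.Build R[i] (hsum H K)
  (dot_normD hsum_dot) (dot_normZ hsum_dot) (@dot_norm_eq0 _ _ hsum_dot).

Lemma hsum_norm x : `|x| ^+ 2 = hsum_dot x x.
Proof. exact: (dot_normK hsum_dot). Qed.

Lemma hsum_norm_le x : `|x| <= `|x.1| + `|x.2|.
Proof.
rewrite -(@ler_pXn2r _ 2%N)// ?nnegrE ?addr_ge0//.
rewrite hsum_norm /hsum_dot -!inner_norm sqrrD lerD2r lerDl.
by rewrite mulrn_wge0// mulr_ge0.
Qed.

Lemma hsum_norm1 x : `|x.1| <= `|x|.
Proof.
by rewrite -(@ler_pXn2r _ 2%N)// ?nnegrE// hsum_norm /hsum_dot -!inner_norm lerDl exprn_ge0.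
Qed.

Lemma hsum_norm2 x : `|x.2| <= `|x|.
Proof.
by rewrite -(@ler_pXn2r _ 2%N)// ?nnegrE// hsum_norm /hsum_dot -!inner_norm lerDr exprn_ge0.
Qed.

Lemma hsum_cauchy_cvg (F : set_system (hsum H K)) :
  ProperFilter F -> cauchy F -> cvg F.
Proof.
move=> FF /cauchyP Fc; apply/cvg_ex.
have part (L : hilbertType R) (h : hsum H K -> L) :
    (forall x y, `|h x - h y| <= `|x - y|) -> exists a : L, h @ F --> a.
  move=> hle; suff hF : cvg (h @ F) by exists (lim (h @ F)).
  apply: cauchy_cvg; apply/cauchyP => e e0.
  have [x Fx] := Fc _ e0; exists (h x).
  change (F (h @^-1` ball (h x) e)); apply: filterS Fx => y.
  rewrite -!ball_normE /= => xy.
  by apply: le_lt_trans (hle _ _) xy.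
have [a Fa] := part _ fst (fun x y => hsum_norm1 (x - y)).
have [b Fb] := part _ snd (fun x y => hsum_norm2 (x - y)).
exists ((a, b) : hsum H K); apply/cvgrPdist_lt => e e0.
have e2 : 0 < e / 2 by rewrite divr_gt0.
move/cvgrPdist_lt : Fa => /(_ _ e2) Fa; move/cvgrPdist_lt : Fb => /(_ _ e2) Fb.
near=> z.
rewrite (le_lt_trans (hsum_norm_le _))//= [ltRHS]splitr ltrD//; near: z => //.
Unshelve. all: by end_near. Qed.

HB.instance Definition _ := Uniform_isComplete.Build (hsum H K) hsum_cauchy_cvg.

HB.instance Definition _ :=
  NormedModule_isHilbert.Build R (hsum H K) hsum_norm.

End hsum.

#[global] Existing Instance totally_filter.

Section sums.
Variables (R : realType) (I : choiceType).
Implicit Types (f g : I -> R[i]) (J K : {fset I}).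

Lemma partial_sumE (V : zmodType) (f : I -> V) J :
  partial_sum f J = \sum_(i <- J) f i.
Proof. by rewrite /partial_sum -(big_seq_fsetE _ _ predT). Qed.

Lemma partial_sum_split (V : zmodType) (f : I -> V) J K : (J `<=` K)%fset ->
  partial_sum f K = partial_sum f J + partial_sum f (K `\` J)%fset.
Proof.
move=> JK; rewrite !partial_sumE.
rewrite (big_fsetID _ (mem J))/=; congr (_ + _); apply: eq_fbigl => i.
  by rewrite !inE/= andbC; case: (boolP (i \in J)) => //= /(fsubsetP JK).
by rewrite !inE/= andbC.
Qed.

Definition summ_bounded f := exists M : R, forall J,
  partial_sum (fun i => `|f i|) J <= M%:C.

Lemma summ_bounded_cvg f : summ_bounded f -> cvg (partial_sum f @ totally).
Proof.
move=> [M fM].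
have real_ps J : partial_sum (fun i => `|f i|) J \is Num.real.
  by rewrite partial_sumE rpred_sum// => i _; exact: normr_real.
pose s J := complex.Re (partial_sum (fun i => `|f i|) J).
have sE J : (s J)%:C = partial_sum (fun i => `|f i|) J by rewrite RRe_real.
have hs : has_sup (range s).
  split; first by exists (s fset0); exists fset0.
  by exists M => _ [J _ <-]; rewrite -lecR sE.
apply: cauchy_cvg; apply/cauchyP => e e0.
have er : e = (complex.Re e)%:C by rewrite RRe_real ?gtr0_real.
have e1 : 0 < complex.Re e by rewrite -ltcR -er.
have [_ [J _ <-] Js] := sup_adherent e1 hs.
exists (partial_sum f J).
exists J => // K /= JK; rewrite -ball_normE /=.
rewrite (partial_sum_split f JK) opprD addNKr normrN.
apply: (@le_lt_trans _ _ (partial_sum (fun i => `|f i|) (K `\` J)%fset)).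
  by rewrite !partial_sumE; exact: ler_norm_sum.
have -> : partial_sum (fun i => `|f i|) (K `\` J)%fset = (s K - s J)%:C.
  by rewrite rmorphB/= !sE (partial_sum_split _ JK) addrC addKr.
rewrite er ltcR ltrBlDr -ltrBlDl (le_lt_trans _ Js)//.
by rewrite lerB// ub_le_sup//; case: hs.
Qed.
End sums.

Section l2.
Variables (R : realType) (I : choiceType).

Definition square_summable (x : I -> R[i]) : Prop :=
  exists M : R, forall J : {fset I},
    partial_sum (fun i => `|x i| ^+ 2) J <= M%:C.

Definition l2_pred : {pred I -> R[i]} := fun x => `[< square_summable x >].

Lemma l2_pred_submod : submod_closed l2_pred.
Proof.
split.
  apply/asboolP; exists 0 => J; rewrite partial_sumE big1// => i _.
  by rewrite normr0 expr0n.
move=> a x y /asboolP[M xM] /asboolP[N yN]; apply/asboolP.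
exists (complex.Re (`|a| ^+ 2 * M%:C *+ 2 + N%:C *+ 2)) => J.
have M0 : 0 <= M%:C by have := xM fset0; rewrite partial_sumE big_seq_fset0.
have N0 : 0 <= N%:C by have := yN fset0; rewrite partial_sumE big_seq_fset0.
rewrite RRe_real; last first.
  by apply: ger0_real; rewrite addr_ge0 ?mulrn_wge0 ?mulr_ge0 ?exprn_ge0.
apply: (@le_trans _ _ (`|a| ^+ 2 * partial_sum (fun i => `|x i| ^+ 2) J *+ 2
   + partial_sum (fun i => `|y i| ^+ 2) J *+ 2)); last first.
  by rewrite lerD ?lerMn2r/= ?ler_wpM2l ?exprn_ge0 ?xM ?yN.
rewrite !partial_sumE mulr_sumr -!sumrMnl -big_split/= ler_sum// => i _.
apply: (@le_trans _ _ ((`|a| * `|x i| + `|y i|) ^+ 2)).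
  rewrite ler_pXn2r ?nnegrE ?addr_ge0 ?mulr_ge0//.
  by rewrite (le_trans (ler_normD _ _))// normrM.
rewrite -subr_ge0.
have -> : `|a| ^+ 2 * `|x i| ^+ 2 *+ 2 + `|y i| ^+ 2 *+ 2 -
    (`|a| * `|x i| + `|y i|) ^+ 2 = (`|a| * `|x i| - `|y i|) ^+ 2 by ring.
by rewrite real_exprn_even_ge0// rpredB ?rpredM ?normr_real.
Qed.

HB.instance Definition _ :=
  GRing.isSubmodClosed.Build R[i] (I -> R[i]) l2_pred l2_pred_submod.

Record l2 : Type := L2 { l2_fun :> I -> R[i]; l2_mem : l2_fun \in l2_pred }.

HB.instance Definition _ := [isSub for l2_fun].
HB.instance Definition _ := [Choice of l2 by <:].
HB.instance Definition _ := [SubChoice_isSubLmodule of l2 by <:].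

Implicit Types x y z : l2.

Lemma l2_ext x y : (forall i, x i = y i) -> x = y.
Proof. by move=> xy; apply/val_inj/funext. Qed.

Lemma l2P x : square_summable x.
Proof. by case: x => f fP; apply/asboolP. Qed.

Lemma l2DE x y i : (x + y) i = x i + y i. Proof. by []. Qed.
Lemma l2ZE (a : R[i]) x i : (a *: x) i = a * x i. Proof. by []. Qed.

(* [sum] is the unordered sum: the limit of the finite partial sums along the
   filter [totally]. *)
Definition l2_dot x y : R[i] := sum (fun i => x i * (y i)^*%R).

Lemma l2_dot_cvg x y : partial_sum (fun i => x i * (y i)^*%R) @ totally
  --> l2_dot x y.
Proof.
apply: summ_bounded_cvg; have [M xM] := l2P x; have [N yN] := l2P y.
exists (M + N) => J; rewrite rmorphD/= (le_trans _ (lerD (xM J) (yN J)))//.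
rewrite !partial_sumE -big_split/= ler_sum// => i _.
rewrite normrM norm_conjC.
have h : 0 <= (`|x i| - `|y i|) ^+ 2.
  by rewrite real_exprn_even_ge0// rpredB ?normr_real.
have h2 : `|x i| * `|y i| *+ 2 <= `|x i| ^+ 2 + `|y i| ^+ 2.
  rewrite -subr_ge0; apply: (le_trans h); rewrite le_eqVlt; apply/orP; left.
  by apply/eqP; ring.
by apply: le_trans h2; rewrite mulr2n lerDl mulr_ge0.
Qed.
End l2.

Section complex_limits.
Variables (R : realType) (T : Type) (F : set_system T).
Context {FF : ProperFilter F}.
Implicit Types (f : T -> R[i]) (l r : R[i]).

Lemma complex_cvg_ge0 f l : (\forall t \near F, 0 <= f t) -> f @ F --> l -> 0 <= l.
Proof.
move=> f0 fl.
have nl : (fun t => `|f t|) @ F --> (`|l| : R[i]) by exact: cvg_norm.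
have nl' : (fun t => `|f t|) @ F --> (l : R[i]).
  apply: cvg_trans fl; apply: near_eq_cvg.
  by apply: filterS f0 => t /ger0_norm ->.
suff -> : l = `|l| by [].
exact: (cvg_unique (@norm_hausdorff _ R[i]) nl' nl).
Qed.

Lemma complex_cvg_ge f l r : (\forall t \near F, r <= f t) -> f @ F --> l -> r <= l.
Proof.
move=> rf fl; rewrite -subr_ge0.
apply: (@complex_cvg_ge0 (fun t => f t - r)).
  by apply: filterS rf => t; rewrite subr_ge0.
exact: cvgB fl (cvg_cst r).
Qed.

Lemma complex_cvg_le f l r : (\forall t \near F, f t <= r) -> f @ F --> l -> l <= r.
Proof.
move=> rf fl; rewrite -subr_ge0.
apply: (@complex_cvg_ge0 (fun t => r - f t)).
  by apply: filterS rf => t; rewrite subr_ge0.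
exact: cvgB (cvg_cst r) fl.
Qed.

Lemma complex_cvg_conj f l : f @ F --> l -> (fun t => (f t)^*%R) @ F --> l^*%R.
Proof.
move=> /cvgrPdist_lt fl; apply/cvgrPdist_lt => e e0.
by apply: filterS (fl e e0) => t; rewrite -rmorphB norm_conjC.
Qed.
End complex_limits.

Section l2_hilbert.
Variables (R : realType) (I : choiceType).
Implicit Types x y z : l2 R I.

Lemma l2_dot_unique x y (s : R[i]) :
  partial_sum (fun i => x i * (y i)^*%R) @ totally --> s -> l2_dot x y = s.
Proof. exact: (@cvg_unique R[i] (@norm_hausdorff _ R[i]) _ _ _ _ (@l2_dot_cvg R I x y)). Qed.

Lemma l2_dot_herm x y : l2_dot x y = (-1) ^+ false * (l2_dot y x)^*%R.
Proof.
rewrite expr0 mul1r; apply: l2_dot_unique.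
have h := @complex_cvg_conj R _ _ _ _ _ (@l2_dot_cvg R I y x).
suff -> : partial_sum (fun i => x i * (y i)^*%R) =
    (fun J => (partial_sum (fun i => y i * (x i)^*%R) J)^*%R) by exact: h.
apply/funext => J; rewrite !partial_sumE rmorph_sum/=.
by apply: eq_bigr => i _; rewrite rmorphM/= conjCK mulrC.
Qed.

Lemma l2_dot_linearl (y : l2 R I) : linear_for *%R (@l2_dot R I ^~ y).
Proof.
move=> a x z; apply: l2_dot_unique.
have h1 : (fun J => a * partial_sum (fun i => x i * (y i)^*%R) J) @ totally
    --> a * l2_dot x y by apply: cvgMr; exact: l2_dot_cvg.
have h : ((fun J => a * partial_sum (fun i => x i * (y i)^*%R) J) \+
    partial_sum (fun i => z i * (y i)^*%R)) @ totally
    --> a * l2_dot x y + l2_dot z y by apply: (cvgD h1); exact: l2_dot_cvg.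
suff -> : partial_sum (fun i => (a *: x + z) i * (y i)^*%R) =
    (fun J => a * partial_sum (fun i => x i * (y i)^*%R) J) \+
    partial_sum (fun i => z i * (y i)^*%R) by exact: h.
apply/funext => J /=; rewrite !partial_sumE mulr_sumr -big_split/=.
by apply: eq_bigr => i _; rewrite mulrA -mulrDl.
Qed.

Lemma l2_dot_bilinear :
  bilinear_for *%R (@Num.conj R[i] \; *%R) (@l2_dot R I).
Proof.
split => [y|x]; first exact: l2_dot_linearl.
move=> a y z; rewrite l2_dot_herm l2_dot_linearl.
rewrite (l2_dot_herm x y) (l2_dot_herm x z) !expr0 !mul1r.
by rewrite rmorphD rmorphM.
Qed.

HB.instance Definition _ := bilinear_isBilinear.Build R[i] (l2 R I) (l2 R I)
  R[i] *%R (@Num.conj R[i] \; *%R) (@l2_dot R I) l2_dot_bilinear.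

HB.instance Definition _ := isHermitianSesquilinear.Build R[i] (l2 R I) false
  (@Num.conj R[i]) (@l2_dot R I) l2_dot_herm.

Lemma l2_dot_ge x J : partial_sum (fun i => `|x i| ^+ 2) J <= l2_dot x x.
Proof.
apply: complex_cvg_ge (@l2_dot_cvg R I x x); exists J => // K /= JK.
rewrite [leRHS](partial_sum_split _ JK).
have -> : partial_sum (fun i => `|x i| ^+ 2) J =
          partial_sum (fun i => x i * (x i)^*%R) J.
  by congr partial_sum; apply/funext => i; rewrite normCK.
by rewrite lerDl partial_sumE sumr_ge0// => i _; rewrite -normCK exprn_ge0.
Qed.

Lemma l2_dot_le x (M : R[i]) :
  (forall J, partial_sum (fun i => `|x i| ^+ 2) J <= M) -> l2_dot x x <= M.
Proof.
move=> h; apply: complex_cvg_le (@l2_dot_cvg R I x x); near=> J.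
apply: le_trans (h J); rewrite le_eqVlt; apply/orP; left; apply/eqP.
by congr partial_sum; apply/funext => i; rewrite normCK.
Unshelve. all: by end_near. Qed.

Lemma l2_coord_le x i : `|x i| ^+ 2 <= l2_dot x x.
Proof.
by apply: le_trans (l2_dot_ge x [fset i]%fset); rewrite partial_sumE big_seq_fset1.
Qed.

Lemma l2_dot_gt0 x : x != 0 -> 0 < l2_dot x x.
Proof.
move=> x0; rewrite lt_def (le_trans _ (l2_dot_ge x fset0)) ?andbT; last first.
  by rewrite partial_sumE big_seq_fset0.
apply: contra_neq x0 => x0; apply: l2_ext => i.
have := l2_coord_le x i; rewrite x0 => xi0.
have /eqP : `|x i| ^+ 2 = 0 by apply: le_anti; rewrite xi0 exprn_ge0.
by rewrite expf_eq0/= normr_eq0 => /eqP ->.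
Qed.

HB.instance Definition _ := isDotProduct.Build R[i] (l2 R I)
  (@l2_dot R I) l2_dot_gt0.

HB.instance Definition _ := Lmodule_isNormed.Build R[i] (l2 R I)
  (dot_normD (@l2_dot R I)) (dot_normZ (@l2_dot R I))
  (@dot_norm_eq0 _ _ (@l2_dot R I)).

Lemma l2_norm x : `|x| ^+ 2 = l2_dot x x.
Proof. exact: (dot_normK (@l2_dot R I)). Qed.

Lemma l2_norm_coord x i : `|x i| <= `|x|.
Proof. by rewrite -(@ler_pXn2r _ 2%N)// ?nnegrE// l2_norm l2_coord_le. Qed.

Lemma l2_cauchy_cvg (F : set_system (l2 R I)) :
  ProperFilter F -> cauchy F -> cvg F.
Proof.
move=> FF /cauchyP Fc; apply/cvg_ex.
have /choice[l Fl] i : exists a : R[i], (fun x => x i) @ F --> a.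
  suff hF : cvg ((fun x : l2 R I => x i) @ F) by exists (lim ((fun x : l2 R I => x i) @ F)).
  apply: cauchy_cvg; apply/cauchyP => e e0.
  have [x Fx] := Fc _ e0; exists (x i).
  change (F ((fun x : l2 R I => x i) @^-1` ball (x i) e)); apply: filterS Fx => y.
  rewrite -!ball_normE /= => xy.
  by apply: le_lt_trans xy; exact: (l2_norm_coord (x - y)).
have key (x : l2 R I) (e : R[i]) : 0 < e -> F (ball x e) -> forall J,
    partial_sum (fun i => `|x i - l i| ^+ 2) J <= e ^+ 2.
  move=> e0 Fx J.
  have lim (s : seq I) : (fun y : l2 R I => \sum_(i <- s) `|x i - y i| ^+ 2) @ F
      --> (\sum_(i <- s) `|x i - l i| ^+ 2 : R[i]).
    elim: s => [|i s ih].
      rewrite big_nil (_ : (fun y => _) = fun=> 0); first exact: cvg_cst.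
      by apply/funext => y; rewrite big_nil.
    rewrite big_cons (_ : (fun y => _) = fun y : l2 R I =>
      `|x i - y i| * `|x i - y i| + \sum_(j <- s) `|x j - y j| ^+ 2); last first.
      by apply/funext => y; rewrite big_cons.
    have hi : (fun y : l2 R I => `|x i - y i|) @ F --> (`|x i - l i| : R[i]).
      by apply: cvg_norm; exact: cvgB (cvg_cst (x i)) (Fl i).
    exact: cvgD (cvgM hi hi) ih.
  rewrite partial_sumE.
  apply: complex_cvg_le (lim J); apply: filterS Fx => y; rewrite -ball_normE /= => xy.
  rewrite -partial_sumE.
  apply: le_trans (l2_dot_ge (x - y) J) _.
  by rewrite -l2_norm ler_pXn2r ?nnegrE// ltW.
have [x0 Fx0] := Fc _ (@ltr01 R[i]).
have lx0 : (fun i => x0 i - l i) \in @l2_pred R I.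
  by apply/asboolP; exists 1 => J; rewrite (le_trans (key _ _ ltr01 Fx0 J))// expr1n.
have lP : l \in @l2_pred R I.
  have -> : l = l2_fun x0 - (fun i => x0 i - l i).
    by apply/funext => i; rewrite !fctE opprB addrC subrK.
  by apply: rpredB => //; exact: l2_mem.
exists (L2 lP); apply/cvgrPdist_lt => e e0.
have e2 : 0 < e / 2 by rewrite divr_gt0.
have [x Fx] := Fc _ e2.
have xl : `|x - L2 lP| <= e / 2.
  rewrite -(@ler_pXn2r _ 2%N)// ?nnegrE ?(ltW e2)// l2_norm.
  by apply: l2_dot_le => J; exact: key.
apply: filterS Fx => y; rewrite -ball_normE /= => xy.
rewrite -(subrKA x) (le_lt_trans (ler_normD _ _))//.
by rewrite [ltRHS]splitr distrC ler_ltD.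
Qed.

HB.instance Definition _ := Uniform_isComplete.Build (l2 R I) l2_cauchy_cvg.

HB.instance Definition _ :=
  NormedModule_isHilbert.Build R (l2 R I) l2_norm.

End l2_hilbert.

Section l2_operators.
Variables (R : realType) (I : choiceType).
Implicit Types (x y : l2 R I) (f : I -> I) (c : I -> R[i]).

Lemma l2_comp_subproof f (f_inj : injective f) x :
  (fun i => x (f i)) \in @l2_pred R I.
Proof.
have [M xM] := l2P x; apply/asboolP; exists M => J.
apply: le_trans (xM (f @` J)%fset); rewrite !partial_sumE.
by rewrite big_imfset//= => i j _ _; exact: f_inj.
Qed.

Definition l2_comp f (f_inj : injective f) x : l2 R I :=
  L2 (l2_comp_subproof f_inj x).

Lemma l2_mul_subproof c (c1 : forall i, `|c i| <= 1) x :
  (fun i => c i * x i) \in @l2_pred R I.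
Proof.
have [M xM] := l2P x; apply/asboolP; exists M => J.
apply: le_trans (xM J); rewrite !partial_sumE ler_sum// => i _.
by rewrite normrM exprMn ler_piMl ?exprn_ge0// exprn_ile1.
Qed.

Definition l2_mul c (c1 : forall i, `|c i| <= 1) x : l2 R I :=
  L2 (l2_mul_subproof c1 x).

Lemma l2_delta_subproof (i : I) : (fun j => (j == i)%:R) \in @l2_pred R I.
Proof.
apply/asboolP; exists 1 => J; rewrite partial_sumE.
have [iJ|iJ] := boolP (i \in J).
  rewrite (big_fsetD1 i)//= eqxx normr1 expr1n big1_fset ?addr0// => j.
  by rewrite !inE => /andP[/negbTE ->] _ _; rewrite normr0 expr0n.
rewrite big1_fset// => j jJ _; case: eqP => [ji|_]; last by rewrite normr0 expr0n.
by rewrite -ji jJ in iJ.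
Qed.

Definition l2_delta (i : I) : l2 R I := L2 (l2_delta_subproof i).

End l2_operators.

Section l2Z_operators.
Variable R : realType.

Definition l2Z : hilbertType R := l2 R int.

(* On the standard basis these are e_n |-> e_(n+1), e_n |-> e_(-n) and
   e_n |-> sign(n) e_n; see the three [_delta] lemmas at the end of the
   section. *)
Definition l2_shift : l2Z -> l2Z :=
  l2_comp (addIr (- 1) : injective (fun n : int => n - 1)).

Definition l2_flip : l2Z -> l2Z := l2_comp (@oppr_inj int).

Definition zsign (n : int) : R[i] := if 0 <= n then 1 else -1.

Lemma zsign_le1 n : `|zsign n| <= 1.
Proof. by rewrite /zsign; case: ifP; rewrite ?normrN normr1. Qed.

Definition l2_sign : l2Z -> l2Z := l2_mul zsign_le1.

Lemma l2_shift_delta n : l2_shift (l2_delta R n) = l2_delta R (n + 1).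
Proof. by apply: l2_ext => k /=; rewrite subr_eq. Qed.

Lemma l2_flip_delta n : l2_flip (l2_delta R n) = l2_delta R (- n).
Proof. by apply: l2_ext => k /=; rewrite eqr_oppLR. Qed.

Lemma l2_sign_delta n : l2_sign (l2_delta R n) = zsign n *: l2_delta R n.
Proof.
apply: l2_ext => k; rewrite l2ZE /=.
by have [->//|] := eqVneq k n; rewrite !mulr0.
Qed.

End l2Z_operators.

(* Unital C*-algebras. The norm is a field of its own because a ring that is
   also a normedModType is not a declarable structure: the join would have to
   precede numDomainType in the hierarchy. *)
HB.mixin Record isCstarAlgebra (R : realType) A of GRing.Algebra R[i] A := {
  star : A -> A;
  cnorm : A -> R[i];
  starD : {morph star : a b / a + b};
  starZ : forall (k : R[i]) a, star (k *: a) = k^*%R *: star a;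
  starM : forall a b, star (a * b) = star b * star a;
  starK : involutive star;
  cnormD : forall a b, cnorm (a + b) <= cnorm a + cnorm b;
  cnormZ : forall (k : R[i]) a, cnorm (k *: a) = `|k| * cnorm a;
  cnorm_eq0 : forall a, cnorm a = 0 -> a = 0;
  cnormM : forall a b, cnorm (a * b) <= cnorm a * cnorm b;
  cnorm_star : forall a, cnorm (star a * a) = cnorm a ^+ 2;
  cnorm_complete : forall a : nat -> A,
    (forall e : R[i], 0 < e -> exists N, forall m n,
      (N <= m)%N -> (N <= n)%N -> cnorm (a m - a n) < e) ->
    exists l : A, forall e : R[i], 0 < e ->
      exists N, forall n, (N <= n)%N -> cnorm (a n - l) < e }.

#[short(type="cstarType")]
HB.structure Definition CstarAlgebra (R : realType) :=
  {A of isCstarAlgebra R A & GRing.Algebra R[i] A}.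

Section operators.
Variables (R : realType) (H : hilbertType R).
Implicit Types (T B : H -> H) (x y : H).

Definition bounded_operator T : Prop :=
  linear T /\ exists M : R, forall x, `|T x| <= M%:C * `|x|.

Definition self_adjoint T : Prop :=
  bounded_operator T /\ forall x y, inner (T x) y = inner x (T y).

Definition positive_operator T : Prop :=
  bounded_operator T /\ forall x, 0 <= inner (T x) x.

Definition compact_operator T : Prop :=
  bounded_operator T /\ precompact (T @` [set x : H | `|x| <= 1]).

Definition commutator T B : H -> H := fun x => T (B x) - B (T x).

Definition orthonormal_basis (I : choiceType) (b : I -> H) : Prop :=
  (forall i j, inner (b i) (b j) = (i == j)%:R) /\
  closure [set x : H | exists (s : seq I) (c : I -> R[i]),
    x = \sum_(i <- s) c i *: b i] = setT.

(* B = |T|: B is positive and B^2 = T^* T. *)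
Definition is_absolute_value T B : Prop :=
  positive_operator B /\ forall x y, inner (B (B x)) y = inner (T x) (T y).

(* T is trace class when Tr |T| = \sum_i <|T| b_i, b_i> is finite in an
   orthonormal basis (b_i); neither this nor the value of
   Tr T = \sum_i <T b_i, b_i> depends on the basis. *)
Definition trace_class T : Prop :=
  bounded_operator T /\
  exists (B : H -> H) (I : choiceType) (b : I -> H),
    [/\ is_absolute_value T B, orthonormal_basis b &
        cvg (partial_sum (fun i => inner (B (b i)) (b i)) @ totally)].

Definition is_trace T (t : R[i]) : Prop :=
  trace_class T /\
  exists (I : choiceType) (b : I -> H), orthonormal_basis b /\
    partial_sum (fun i => inner (T (b i)) (b i)) @ totally --> t.

End operators.

Section fredholm.
Variables (R : realType) (A : cstarType R).

(* The representation need not be unital. *)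
Definition star_representation (H : hilbertType R) (pi : A -> H -> H) : Prop :=
  [/\ forall a, bounded_operator (pi a),
      forall (k : R[i]) a b x, pi (k *: a + b) x = k *: pi a x + pi b x,
      forall a b x, pi (a * b) x = pi a (pi b x) &
      forall a x y, inner (pi (star a) x) y = inner x (pi a y)].

Record module_data := ModuleData {
  md_space : hilbertType R;
  md_rep : A -> md_space -> md_space;
  md_F : md_space -> md_space;
  md_grading : md_space -> md_space }.

Definition even_fredholm_module (w : module_data) : Prop :=
  let pi := @md_rep w in let F := @md_F w in let gamma := @md_grading w in
  [/\ star_representation pi,
      self_adjoint F /\ (forall x, F (F x) = x),
      forall a, compact_operator (commutator F (pi a)),
      self_adjoint gamma /\ (forall x, gamma (gamma x) = x) &
      (forall a x, gamma (pi a x) = pi a (gamma x)) /\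
      (forall x, F (gamma x) = - gamma (F x))].

Definition projection (P : A) : Prop := star P = P /\ P * P = P.

(* <ch_* w, [P]> = z for the class in K_0 of a projection P of A, that is
     lim_n (-1)^n Tr (gamma pi(P) [F, pi(P)]^(2n)) = z.
   The commutator [F, pi(P)] is skew-adjoint, so that asking [F, pi(P)]^(2n) to
   be trace class is asking [F, pi(P)] to be in the Schatten ideal L^(2n): this
   is the summability under which the traces are defined. *)
Definition chern_pairing (w : module_data) (P : A) (z : R[i]) : Prop :=
  let pi := @md_rep w in let F := @md_F w in let gamma := @md_grading w in
  let dP n := iter (2 * n) (commutator F (pi P)) in
  projection P /\
  exists t : nat -> R[i],
    (\forall n \near \oo,
       trace_class (dP n) /\
       is_trace (fun x => gamma (pi P (dP n x))) (t n)) /\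
    (fun n => (-1) ^+ n * t n) @ \oo --> z.

End fredholm.

Definition pullback_module (R : realType) (A B : cstarType R) (alpha : A -> B)
    (w : module_data B) : module_data A :=
  ModuleData (fun a => @md_rep _ _ w (alpha a)) (@md_F _ _ w) (@md_grading _ _ w).

Definition unitary_representation (R : realType) (G : groupType)
    (H : hilbertType R) (U : G -> H -> H) : Prop :=
  [/\ forall g, linear (U g),
      forall x, U 1%g x = x,
      forall g h x, U (g * h)%g x = U g (U h x) &
      forall g x y, inner (U g x) (U g y) = inner x y].

(* (A, u) is a model of C^*(G): u is a unitary representation of G in A whose
   linear span is dense, and every unitary representation of G on a Hilbert
   space factors through A. This determines (A, u) up to isomorphism. *)
Definition is_group_cstar (R : realType) (G : groupType) (A : cstarType R)
    (u : G -> A) : Prop :=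
  [/\ u 1%g = 1 /\ (forall g h, u (g * h)%g = u g * u h),
      forall g, star (u g) = u g^-1%g,
      forall (a : A) (e : R[i]), 0 < e -> exists (s : seq G) (c : G -> R[i]),
        cnorm (a - \sum_(g <- s) c g *: u g) < e &
      forall (H : hilbertType R) (U : G -> H -> H), unitary_representation U ->
        exists pi : A -> H -> H,
          star_representation pi /\ forall g x, pi (u g) x = U g x].

(* The semidirect product of Z by Z_2, acting by n |-> - n; [true] is the
   nontrivial element of Z_2. *)
Definition dihedral : Type := (int * bool)%type.

Section dihedral.
HB.instance Definition _ := Choice.copy dihedral (int * bool)%type.

Definition dihedral_mul (g h : dihedral) : dihedral :=
  (g.1 + (if g.2 then - h.1 else h.1), g.2 (+) h.2).
Definition dihedral_one : dihedral := (0, false).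
Definition dihedral_inv (g : dihedral) : dihedral :=
  (if g.2 then g.1 else - g.1, g.2).

Lemma dihedral_mulA : associative dihedral_mul.
Proof.
move=> [m a] [n b] [p c]; rewrite /dihedral_mul/= addbA.
by case: a; case: b; rewrite /= ?opprD ?opprK addrA.
Qed.
Lemma dihedral_mul1 : left_id dihedral_one dihedral_mul.
Proof. by move=> [m a]; rewrite /dihedral_mul/= add0r. Qed.
Lemma dihedral_mulr1 : right_id dihedral_one dihedral_mul.
Proof. by move=> [m a]; rewrite /dihedral_mul/= oppr0 if_same addr0 addbF. Qed.
Lemma dihedral_mulV : left_inverse dihedral_one dihedral_inv dihedral_mul.
Proof. by move=> [m []]; rewrite /dihedral_mul/= ?subrr ?addNr. Qed.
Lemma dihedral_mulrV : right_inverse dihedral_one dihedral_inv dihedral_mul.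
Proof. by move=> [m []]; rewrite /dihedral_mul/= subrr. Qed.

HB.instance Definition _ := isGroup.Build dihedral dihedral_mulA
  dihedral_mul1 dihedral_mulr1 dihedral_mulV dihedral_mulrV.
End dihedral.

Definition transl : dihedral := (1, false).
Definition refl : dihedral := (0, true).

(* The operator on H (+) H with matrix (a b; c d). *)
Definition block_op (R : realType) (H : hilbertType R) (a b c d : H -> H)
    (x : hsum H H) : hsum H H := (a x.1 + b x.2, c x.1 + d x.2).

Section modules.
Variables (R : realType) (A : cstarType R).
Local Notation O := (fun=> 0).

Definition block_grading (H : hilbertType R) : hsum H H -> hsum H H :=
  block_op id O O -%R.

Definition w0 (phi : A -> R[i]) : module_data A :=
  @ModuleData R A (hsum R[i] R[i])
    (fun a => block_op (fun x => phi a * x) O O O)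
    (block_op O id id O) (@block_grading R[i]).

(* Here pi is meant to be the representation pi_1, which is determined by its
   values on the generators S and e of A. *)
Definition w1 (pi : A -> hsum (l2Z R) (l2Z R) -> hsum (l2Z R) (l2Z R)) :
    module_data A :=
  @ModuleData R A (hsum (l2Z R) (l2Z R)) pi
    (block_op O (fun x => 'i%C *: l2_sign x) (fun x => - 'i%C *: l2_sign x) O)
    (@block_grading (l2Z R)).
End modules.

(* Main.v *)
Require Import Defs.
From HB Require Import structures.
From mathcomp Require Import all_boot all_order all_algebra complex finmap zify ring lra.
From mathcomp Require Import sesquilinear.
From mathcomp Require Import all_classical reals topology normedtype sequences.
From mathcomp.analysis.showcase Require Import summability.

Set Implicit Arguments.
Unset Strict Implicit.
Unset Printing Implicit Defensive.

Import Order.TTheory GRing.Theory Num.Theory.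
Import numFieldNormedType.Exports.

Local Open Scope classical_set_scope.
Local Open Scope ring_scope.
Local Open Scope complex_scope.

(** The nine pairings come from one computation. For a projection [P] put
[p = pi P] and [C = [F, p]]. If [C^4 = - C^2], then [E = - C^2] is an orthogonal
projection commuting with [p], the power [C^(2n)] is [(-1)^n E], and the
sequence that defines the pairing is equal to [Tr (gamma p E)] from [n = 1] on.
This is [chern_pairing_finite_rank].

In the module [w0] of the character [phi], every one of the three projections
has [phi P = 1] and [E] is the identity, so the trace is 1 ([w0_pairing]).

In the module [w1], the element [u (k, true)] acts on both copies of l2(Z)
through the reflection [m |-> k - m], with opposite signs. The commutator of the
sign operator with [(1 + u (k, true)) / 2] detects the integers that the
reflection keeps on the same side of the origin, a finite set, and the graded
trace counts the fixed points of the reflection: one if [k] is even, none if [k]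
is odd ([w1_pairing_reflection]). The projections [(1 + e) / 2] and
[(1 + S e) / 2] are the cases [k = 0] and [k = 1]. The pullback along [alpha]
shifts them to [k = -1] and [k = 0]. The commutator with 1 vanishes.

That [w1] is a Fredholm module requires [[F, pi a]] to be compact for all [a].
It has finite rank when [a] is an element of the group, and these span a dense
subspace, but [pi] is not assumed to be continuous. Continuity is automatic: if
[a] is small, [1 - star a * a] is the square of a self-adjoint element, which
gives [|pi a x| <= |x|] ([rep_norm_le]). Compact operators are then handled as
those having finite nets, a condition that is stable under uniform limits. *)

(** * Inner products *)

Section inner_product.
Variables (R : realType) (H : hilbertType R).
Implicit Types x y z : H.

Lemma innerDl x y z : inner (x + y) z = inner x z + inner y z.
Proof. by rewrite linearDl. Qed.
Lemma innerDr x y z : inner x (y + z) = inner x y + inner x z.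
Proof. by rewrite linearD. Qed.
Lemma innerBl x y z : inner (x - y) z = inner x z - inner y z.
Proof. by rewrite linearBl. Qed.
Lemma innerBr x y z : inner x (y - z) = inner x y - inner x z.
Proof. by rewrite linearB. Qed.
Lemma innerNl x y : inner (- x) y = - inner x y.
Proof. by rewrite linearNl. Qed.
Lemma innerNr x y : inner x (- y) = - inner x y.
Proof. by rewrite linearN. Qed.
Lemma innerZl (k : R[i]) x y : inner (k *: x) y = k * inner x y.
Proof. by rewrite linearZl_LR. Qed.
Lemma innerZr (k : R[i]) x y : inner x (k *: y) = k^*%R * inner x y.
Proof. by rewrite linearZ. Qed.
Lemma inner0l x : inner 0 x = 0.
Proof. by rewrite linear0l. Qed.
Lemma inner0r x : inner x 0 = 0.
Proof. by rewrite linear0r. Qed.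

End inner_product.

(** * The norm of a C*-algebra and square roots *)

Section cstar_norm.
Variables (R : realType) (A : cstarType R).
Implicit Types a b c h : A.

Lemma cnorm0 : cnorm (0 : A) = 0.
Proof. by rewrite -(scale0r (0 : A)) cnormZ normr0 mul0r. Qed.

Lemma cnormN a : cnorm (- a) = cnorm a.
Proof. by rewrite -scaleN1r cnormZ normrN normr1 mul1r. Qed.

Lemma cnorm_ge0 a : 0 <= cnorm a.
Proof.
have := cnormD a (- a); rewrite subrr cnorm0 cnormN -mulr2n.
by rewrite pmulrn_lge0.
Qed.

Lemma cnormBC a b : cnorm (a - b) = cnorm (b - a).
Proof. by rewrite -cnormN opprB. Qed.

Lemma cnorm_triangle c a b : cnorm (a - b) <= cnorm (a - c) + cnorm (c - b).
Proof. by rewrite -[a - b](subrKA c) cnormD. Qed.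

Lemma star0 : star (0 : A) = 0.
Proof. by rewrite -[X in star X](scale0r (0 : A)) starZ rmorph0 scale0r. Qed.

Lemma starN a : star (- a) = - star a.
Proof. by rewrite -scaleN1r starZ rmorphN1 scaleN1r. Qed.

Lemma starB a b : star (a - b) = star a - star b.
Proof. by rewrite starD starN. Qed.

Lemma star1 : star (1 : A) = 1.
Proof. by rewrite -[RHS]starK -[X in _ = star X]mulr1 starM starK mulr1. Qed.

Lemma cnorm_star_isometry a : cnorm (star a) = cnorm a.
Proof.
have le b : cnorm b <= cnorm (star b).
  have [->|b0] := eqVneq (cnorm b) 0; first exact: cnorm_ge0.
  have b_gt0 : 0 < cnorm b by rewrite lt_def b0 cnorm_ge0.
  by rewrite -(ler_pM2r b_gt0) -expr2 -cnorm_star cnormM.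
by apply: le_anti; rewrite le andbT -{2}[a]starK le.
Qed.

(** The order of [R[i]] is only partial; real values of the norm make linear
arithmetic available. *)
Definition rnorm a : R := complex.Re (cnorm a).

Lemma rnormE a : cnorm a = (rnorm a)%:C.
Proof. by rewrite RRe_real ?ger0_real ?cnorm_ge0. Qed.

Lemma rnorm_ge0 a : 0 <= rnorm a.
Proof. by rewrite -lecR -rnormE cnorm_ge0. Qed.

Lemma rnormBC a b : rnorm (a - b) = rnorm (b - a).
Proof. by rewrite /rnorm cnormBC. Qed.

Lemma rnorm_triangle c a b : rnorm (a - b) <= rnorm (a - c) + rnorm (c - b).
Proof. by rewrite -lecR rmorphD/= -!rnormE cnorm_triangle. Qed.

Lemma rnormD a b : rnorm (a + b) <= rnorm a + rnorm b.
Proof. by rewrite -lecR rmorphD/= -!rnormE cnormD. Qed.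

Lemma rnormM a b : rnorm (a * b) <= rnorm a * rnorm b.
Proof. by rewrite -lecR rmorphM/= -!rnormE cnormM. Qed.

Lemma rnorm_half a : rnorm (2^-1 *: a) = rnorm a / 2.
Proof.
apply: complexI; rewrite -rnormE cnormZ ger0_norm ?invr_ge0// rnormE mulrC.
by rewrite rmorphM/= fmorphV/= rmorph_nat.
Qed.

Lemma rnorm_star a : rnorm (star a) = rnorm a.
Proof. by rewrite /rnorm cnorm_star_isometry. Qed.

Lemma rnorm_small_eq0 a : (forall e : R, 0 < e -> rnorm a < e) -> a = 0.
Proof.
move=> small; apply: cnorm_eq0; rewrite rnormE.
have [-> //|a0] := eqVneq (rnorm a) 0.
have /small : 0 < rnorm a by rewrite lt_def a0 rnorm_ge0.
by rewrite ltxx.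
Qed.

Section sqrt.
Variables (h : A) (h_self : star h = h) (h_small : rnorm h <= 3 / 4).

Let c n := iter n (fun x => 2^-1 *: (h + x * x)) (0 : A).

Let cS n : c n.+1 = 2^-1 *: (h + c n * c n). Proof. by []. Qed.

Let c_le n : rnorm (c n) <= 2^-1.
Proof.
elim: n => [|n ih]; first by rewrite /rnorm cnorm0/= invr_ge0.
rewrite cS rnorm_half; have := rnormD h (c n * c n).
have := rnormM (c n) (c n); have := rnorm_ge0 (c n); move: h_small ih; nra.
Qed.

Let c_star n : star (c n) = c n.
Proof.
elim: n => [|n ih]; first exact: star0.
by rewrite cS starZ starD starM h_self ih fmorphV/= conjC_nat.
Qed.

Let c_step a b : rnorm (2^-1 *: (h + a * a) - 2^-1 *: (h + b * b))
  <= (rnorm a + rnorm b) / 2 * rnorm (a - b).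
Proof.
rewrite -scalerBr rnorm_half [h + _]addrC addrKA.
have -> : a * a - b * b = a * (a - b) + (a - b) * b.
  by rewrite mulrBr mulrBl subrKA.
have := rnormD (a * (a - b)) ((a - b) * b).
have := rnormM a (a - b); have := rnormM (a - b) b; lra.
Qed.

Let c_cauchy m n : rnorm (c (n + m)%N - c n) <= 2^-1 ^+ n.
Proof.
elim: n => [|n ih]; first by rewrite add0n subr0 expr0; have := c_le m; lra.
rewrite addSn !cS exprS; apply: le_trans (c_step _ _) _.
have := c_le n; have := c_le (n + m)%N.
have := rnorm_ge0 (c n); have := rnorm_ge0 (c (n + m)%N).
have := rnorm_ge0 (c (n + m)%N - c n); move: ih; nra.
Qed.

(** [1 - c] is a square root of [1 - h] if and only if [c = (h + c^2) / 2].
Iterating the right-hand side from 0 stays in the ball of radius 1/2, because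
[(3/4 + 1/4) / 2 = 1/2], and consecutive iterates approach each other at least
by a factor 1/2. All iterates are self-adjoint, hence so is their limit. *)
Lemma sqrt_one_sub : exists b, star b = b /\ b * b = 1 - h.
Proof.
have [l l_lim] : exists l : A, forall e : R, 0 < e ->
    exists N, forall n, (N <= n)%N -> rnorm (c n - l) < e.
  have [|l l_lim] := @cnorm_complete _ _ c.
    move=> e e0; have er : e = (complex.Re e)%:C by rewrite RRe_real ?gtr0_real.
    rewrite er in e0 *; move: (complex.Re e) e0 => {er} r; rewrite ltcR => r0.
    have half1 : `|2^-1 : R| < 1 by rewrite ger0_norm ?invr_ge0// invf_lt1// ltr1n.
    have /cvgrPdist_lt/(_ _ r0) [N _ Nlt] := cvg_expr half1.
    have bound m n : (N <= n)%N -> (n <= m)%N -> rnorm (c m - c n) < r.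
      move=> Nn /subnKC <-; apply: le_lt_trans (c_cauchy _ _) _.
      by have /= := Nlt _ Nn; rewrite sub0r normrN ger0_norm ?exprn_ge0 ?invr_ge0.
    exists N => m n Nm Nn; rewrite rnormE ltcR.
    case: (leqP n m) => [|/ltnW]; first exact: bound.
    by rewrite rnormBC; apply: bound.
  exists l => e e0; have [|N Nl] := l_lim e%:C; first by rewrite ltcR.
  by exists N => n /Nl; rewrite rnormE ltcR.
have l1 : rnorm l <= 1.
  have [|N /(_ N (leqnn N)) Nl] := l_lim 2^-1; first by rewrite invr_gt0.
  have := rnorm_triangle (c N) l 0; rewrite !subr0 rnormBC.
  by have := c_le N; move: Nl; lra.
have half e : (0 : R) < e -> 0 < e / 2 by move=> ?; rewrite divr_gt0.
have fix_l : l = 2^-1 *: (h + l * l).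
  apply/eqP; rewrite -subr_eq0; apply/eqP; apply: rnorm_small_eq0 => e /half e0.
  have [N Nl] := l_lim _ e0.
  have := rnorm_triangle (c N.+1) l (2^-1 *: (h + l * l)).
  have := Nl _ (leqnSn N); rewrite [rnorm (c _ - l)]rnormBC => lt1.
  have := Nl _ (leqnn N).
  have : (rnorm (c N) + rnorm l) / 2 * rnorm (c N - l) <= rnorm (c N - l).
    by rewrite ler_piMl ?rnorm_ge0//; have := c_le N; move: l1; lra.
  have := c_step (c N) l; rewrite -cS; lra.
have star_l : star l = l.
  apply/eqP; rewrite -subr_eq0; apply/eqP; apply: rnorm_small_eq0 => e /half e0.
  have [N /(_ N (leqnn N)) Nl] := l_lim _ e0.
  apply: le_lt_trans (rnorm_triangle (c N) _ _) _.
  by rewrite -{1}c_star -starB rnorm_star rnormBC [ltRHS]splitr ltrD.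
exists (1 - l); split; first by rewrite starB star1 star_l.
have two_l : l + l = h + l * l.
  rewrite {1 2}fix_l -scalerDl -[RHS]scale1r; congr (_ *: _); by field.
have -> : h = l + l - l * l by rewrite two_l addrK.
by rewrite mulrBl mul1r mulrBr mulr1 -addrA -opprD addrA.
Qed.

End sqrt.

End cstar_norm.

(** * Representations are bounded *)

Section representation_bound.
Variables (R : realType) (A : cstarType R) (H : hilbertType R).
Variables (pi : A -> H -> H) (pi_rep : star_representation pi).
Implicit Types (a b : A) (x y : H).

Lemma repD a b x : pi (a + b) x = pi a x + pi b x.
Proof. by have [_ lin _ _] := pi_rep; rewrite -(scale1r a) lin !scale1r. Qed.

Lemma rep0 x : pi 0 x = 0.
Proof. by apply: (addrI (pi 0 x)); rewrite -repD !addr0. Qed.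

Lemma repZ (k : R[i]) a x : pi (k *: a) x = k *: pi a x.
Proof. by have [_ lin _ _] := pi_rep; rewrite -[k *: a]addr0 lin rep0 addr0. Qed.

Lemma repB a b x : pi (a - b) x = pi a x - pi b x.
Proof. by rewrite repD -scaleN1r repZ scaleN1r. Qed.

Lemma repM a b x : pi (a * b) x = pi a (pi b x).
Proof. by have [] := pi_rep. Qed.

Lemma rep_star a x y : inner (pi (star a) x) y = inner x (pi a y).
Proof. by have [] := pi_rep. Qed.

(** Algebra alone controls the norm of [pi a]: when [star a * a] is small,
[1 - star a * a = b * b] with [b = star b], so that
[|pi a x|^2 = |pi 1 x|^2 - |pi b x|^2 <= |x|^2]. The factor 2 instead of the
optimal 1 leaves room for the square root, which needs [|star a * a| <= 3/4]. *)
Lemma rep_norm_le a x : `|pi a x| <= 2 * cnorm a * `|x|.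
Proof.
have [a0|a_neq0] := eqVneq (cnorm a) 0.
  by rewrite (cnorm_eq0 _ a0) rep0 normr0 cnorm0 mulr0 mul0r.
have a_gt0 : 0 < cnorm a by rewrite lt_def a_neq0 cnorm_ge0.
have k_gt0 : 0 < 2 * cnorm a by rewrite mulr_gt0.
pose a' := (2 * cnorm a)^-1 *: a.
suff a'_le : `|pi a' x| <= `|x|.
  rewrite -ler_pdivrMl//; move: a'_le.
  by rewrite /a' repZ normrZ gtr0_norm ?invr_gt0.
have h_self : star (star a' * a') = star a' * a' by rewrite starM starK.
have h_small : rnorm (star a' * a') <= 3 / 4.
  have -> : rnorm (star a' * a') = 4^-1; last by lra.
  apply: complexI; rewrite -rnormE cnorm_star /a' cnormZ gtr0_norm ?invr_gt0//.
  rewrite invfM -mulrA mulVf// mulr1 fmorphV/= rmorph_nat; by field.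
have [b [b_self bb]] := sqrt_one_sub h_self h_small.
have pi1_le : inner (pi 1 x) x <= inner x x.
  have pi1 y : inner (pi 1 x) (pi 1 y) = inner (pi 1 x) y.
    by rewrite -rep_star star1 -repM mulr1.
  have := dot_ge0 inner (x - pi 1 x).
  rewrite innerBl !innerBr pi1 subrr subr0.
  by rewrite -rep_star star1 subr_ge0.
rewrite -(@ler_pXn2r _ 2%N)// ?nnegrE// !inner_norm -rep_star -repM.
apply: le_trans pi1_le; rewrite -subr_ge0 -innerBl -repB -bb.
by rewrite -{1}b_self repM rep_star dot_ge0.
Qed.

End representation_bound.

(** * Compact operators and finite nets *)

Section finite_nets.
Variables (R : realType) (H : hilbertType R).
Implicit Types (x y z : H) (B : set H) (T : H -> H).

Definition totally_bounded B := forall e : R, 0 < e ->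
  exists s : seq H, forall y, B y -> exists2 z, z \in s & `|y - z| < e%:C.

Lemma ultra_finite_cover (F : set_system H) (P : H -> set H) (s : seq H) :
  UltraFilter F -> F [set y | exists2 z, z \in s & P z y] ->
  exists z, F (P z).
Proof.
move=> FU; elim: s => [|z s ih] Fs.
  by have /filter_ex[y [z]] := Fs.
have [Pz|Pz] := in_ultra_setVsetC (P z) FU; first by exists z.
apply: ih; apply: filterS (filterI Fs Pz) => y /= -[[t]].
rewrite inE => /orP[/eqP -> //|ts Pt _]; by exists t.
Qed.

(** An ultrafilter on the closure of a totally bounded set contains a ball of
each radius, so it is Cauchy and converges. *)
Lemma totally_bounded_precompact B : totally_bounded B -> precompact B.
Proof.
move=> Btb; rewrite precompactE compact_ultra => F FU FB.
have FF : ProperFilter F by exact: ultra_proper.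
suff /cauchy_cvg/cvg_ex[l Fl] : cauchy F.
  exists l; split=> //.
  exact: (@closed_cvg _ _ F FF id _ (@closed_closure _ B) FB l Fl).
apply/cauchyP => e e0; have er : e = (complex.Re e)%:C.
  by rewrite RRe_real ?gtr0_real.
have e2 : 0 < complex.Re e / 2 by rewrite divr_gt0// -ltcR -er.
have [s sB] := Btb _ e2.
apply: (@ultra_finite_cover F (fun z => ball z e) s) => //.
apply: filterS FB => y /(_ (ball y (e / 2))) [].
  by apply: nbhsx_ballx; rewrite divr_gt0.
move=> z [/sB[t ts zt]]; rewrite -ball_normE /= => yz; exists t => //.
rewrite -[t - y](subrKA z) (le_lt_trans (ler_normD _ _))//.
rewrite [ltRHS]splitr ltrD//; last by rewrite distrC.
by rewrite distrC er -(rmorph_nat (real_complex R)) -fmorphV -rmorphM.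
Qed.

Lemma interval_net (M e : R) : 0 < e -> exists s : seq R,
  forall r, `|r| <= M -> exists2 t, t \in s & `|r - t| < e.
Proof.
move=> e0; exists [seq k%:R * e - M | k <- iota 0 (Num.truncn (2 * M / e)).+1].
move=> r; rewrite ler_norml => /andP[Mr rM].
have rM0 : 0 <= (r + M) / e by rewrite divr_ge0 ?(ltW e0)//; lra.
pose k := Num.truncn ((r + M) / e); exists (k%:R * e - M).
  apply/mapP; exists k => //; rewrite mem_iota add0n ltnS leq0n/=.
  by apply: le_truncn; rewrite ler_pM2r ?invr_gt0//; lra.
have /andP[] := truncn_itv rM0; rewrite -/k ler_pdivlMr// ltr_pdivrMr// -natr1.
rewrite mulrDl mul1r => le1 lt1; rewrite ltr_norml; apply/andP; split; lra.
Qed.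

Lemma disc_net (M e : R) : 0 < e -> exists s : seq R[i],
  forall z : R[i], `|z| <= M%:C -> exists2 w, w \in s & `|z - w| < e%:C.
Proof.
move=> e0; have [|s sP] := @interval_net M (e / 2); first by rewrite divr_gt0.
exists [seq a +i* b | a <- s, b <- s] => z zM.
have i1 : `|'i : R[i]| = 1 by rewrite normc_def/= expr0n expr1n add0r sqrtr1.
have [a a_s az] : exists2 a, a \in s & `|complex.Re z - a| < e / 2.
  by apply: sP; rewrite -lecR (le_trans _ zM)// normc_ge_Re.
have [b b_s bz] : exists2 b, b \in s & `|complex.Im z - b| < e / 2.
  apply: sP; rewrite -lecR (le_trans _ zM)// -normrN -ReiNIm.
  by rewrite (le_trans (normc_ge_Re _))// normrM i1 mulr1.
exists (a +i* b); first by apply/allpairsP; exists (a, b).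
have -> : z - a +i* b =
    (complex.Re z - a)%:C + 'i * (complex.Im z - b)%:C.
  by case: z {zM az bz} => c d; rewrite [RHS]complexE; simpc.
rewrite (le_lt_trans (ler_normD _ _))// normrM i1 mul1r !normc_def/= expr0n/=.
by rewrite !addr0 !sqrtr_sqr -rmorphD/= ltcR [ltRHS]splitr ltrD.
Qed.

(** For linear operators this is compactness, in the form in which it passes to
sums and to limits. *)
Definition has_finite_nets T := forall e : R, 0 < e -> exists s : seq H,
  forall x, `|x| <= 1 -> exists2 z, z \in s & `|T x - z| < e%:C.

Lemma finite_nets_compact T : bounded_operator T -> has_finite_nets T ->
  compact_operator T.
Proof.
move=> Tb Tnet; split=> //; apply: totally_bounded_precompact => e e0.
by have [s sP] := Tnet _ e0; exists s => _ [x /= x1 <-]; exact: sP.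
Qed.

Lemma finite_nets0 : has_finite_nets (fun=> 0).
Proof.
move=> e e0; exists [:: 0] => x _; exists 0; first by rewrite inE.
by rewrite subrr normr0 ltcR.
Qed.

Lemma finite_netsD T T' : has_finite_nets T -> has_finite_nets T' ->
  has_finite_nets (fun x => T x + T' x).
Proof.
move=> h h' e e0; have e2 : 0 < e / 2 by rewrite divr_gt0.
have [s sP] := h _ e2; have [s' sP'] := h' _ e2.
exists [seq z + z' | z <- s, z' <- s'] => x x1.
have [z zs zx] := sP _ x1; have [z' zs' zx'] := sP' _ x1.
exists (z + z'); first by apply/allpairsP; exists (z, z').
rewrite opprD addrACA (le_lt_trans (ler_normD _ _))//.
by rewrite [e]splitr rmorphD/= ltrD.
Qed.

Lemma finite_nets_rank1 (f : H -> R[i]) (K : R) (v : H) :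
  (forall x, `|f x| <= K%:C * `|x|) -> has_finite_nets (fun x => f x *: v).
Proof.
move=> fK e e0; have vr : `|v| = (complex.Re `|v|)%:C.
  by rewrite RRe_real ?normr_real.
have v0 : 0 <= complex.Re `|v| by rewrite -lecR -vr normr_ge0.
have e1 : 0 < e / (1 + complex.Re `|v|) by rewrite divr_gt0// ltr_pwDl.
have [s sP] := disc_net `|K| e1.
exists [seq c *: v | c <- s] => x x1; have [|c cs xc] := sP (f x).
  rewrite (le_trans (fK x))// (@le_trans _ _ (`|K|%:C * `|x|))//.
    by rewrite ler_wpM2r// lecR ler_norm.
  by rewrite ler_piMr// lecR.
exists (c *: v); first exact: map_f.
rewrite -scalerBl normrZ vr; apply: (@le_lt_trans _ _
  (`|f x - c| * (1 + complex.Re `|v|)%:C)).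
  by rewrite ler_wpM2l// lecR lerDr.
by rewrite -ltr_pdivlMr ?ltcR ?ltr_pwDl// -fmorphV -rmorphM/=.
Qed.

Lemma finite_nets_sum (I : Type) (s : seq I) (f : I -> H -> R[i]) (K : R)
    (v : I -> H) : (forall i x, `|f i x| <= K%:C * `|x|) ->
  has_finite_nets (fun x => \sum_(i <- s) f i x *: v i).
Proof.
move=> fK; elim: s => [|i s ih].
  rewrite (_ : (fun x => _) = fun=> 0); first exact: finite_nets0.
  by apply/funext => x; rewrite big_nil.
rewrite (_ : (fun x => _) =
    fun x => f i x *: v i + \sum_(j <- s) f j x *: v j).
  by apply: finite_netsD => //; exact: finite_nets_rank1 (fK i).
by apply/funext => x; rewrite big_cons.
Qed.

Lemma finite_nets_limit T : (forall e : R, 0 < e -> exists T',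
    has_finite_nets T' /\ forall x, `|T x - T' x| <= e%:C * `|x|) ->
  has_finite_nets T.
Proof.
move=> lim e e0; have e2 : 0 < e / 2 by rewrite divr_gt0.
have [T' [T'net TT']] := lim _ e2.
have [s sP] := T'net _ e2; exists s => x x1.
have [z zs zx] := sP _ x1; exists z => //.
rewrite -[T x - z](subrKA (T' x)) (le_lt_trans (ler_normD _ _))//.
rewrite [e]splitr rmorphD/= ler_ltD//; apply: le_trans (TT' x) _.
by rewrite ler_piMr// lecR ltW.
Qed.

End finite_nets.

(** * Bounded operators *)

Section bounded_operators.
Variables (R : realType) (H : hilbertType R).
Implicit Types (x y : H) (T B : H -> H).

Lemma op0 T : linear T -> T 0 = 0.
Proof.
by move=> lin; apply: (addrI (T 0)); rewrite -{1}(scale1r (T 0)) -lin scale1r !addr0.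
Qed.

Lemma opZ T (k : R[i]) x : linear T -> T (k *: x) = k *: T x.
Proof. by move=> lin; rewrite -[k *: x]addr0 lin op0// addr0. Qed.

Lemma opD T x y : linear T -> T (x + y) = T x + T y.
Proof. by move=> lin; rewrite -{1}(scale1r x) lin scale1r. Qed.

Lemma opN T x : linear T -> T (- x) = - T x.
Proof. by move=> lin; rewrite -scaleN1r opZ// scaleN1r. Qed.

Lemma opB T x y : linear T -> T (x - y) = T x - T y.
Proof. by move=> lin; rewrite opD// opN. Qed.

Lemma bounded_operator_ge0 T : bounded_operator T ->
  exists2 M : R, 0 <= M & forall x, `|T x| <= M%:C * `|x|.
Proof.
move=> [_ [M TM]]; exists `|M| => // x; apply: le_trans (TM x) _.
by rewrite ler_wpM2r// lecR ler_norm.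
Qed.

Lemma bounded_operator_comp T B : bounded_operator T -> bounded_operator B ->
  bounded_operator (fun x => T (B x)).
Proof.
move=> Tb Bb; split.
  by move=> k x y; rewrite Bb.1 Tb.1.
have [M M0 TM] := bounded_operator_ge0 Tb; have [N N0 BN] := bounded_operator_ge0 Bb.
exists (M * N) => x; apply: le_trans (TM _) _.
by rewrite rmorphM/= -mulrA ler_wpM2l// lecR.
Qed.

Lemma bounded_operatorB T B : bounded_operator T -> bounded_operator B ->
  bounded_operator (fun x => T x - B x).
Proof.
move=> [Tl [M TM]] [Bl [N BN]]; split.
  by move=> k x y; rewrite Tl Bl scalerBr opprD addrACA.
exists (M + N) => x; apply: le_trans (ler_normB _ _) _.
by rewrite rmorphD/= mulrDl lerD.
Qed.

Lemma bounded_operatorZ (k : R[i]) T : bounded_operator T ->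
  bounded_operator (fun x => k *: T x).
Proof.
move=> [Tl [M TM]]; split.
  by move=> c x y; rewrite Tl scalerDr !scalerA mulrC.
have [r kr] : exists r : R, `|k| = r%:C.
  by exists (complex.Re `|k|); rewrite RRe_real ?normr_real.
exists (r * M) => x; rewrite normrZ rmorphM/= -kr.
by rewrite -mulrA ler_wpM2l.
Qed.

Lemma bounded_commutator T B : bounded_operator T -> bounded_operator B ->
  bounded_operator (commutator T B).
Proof. by move=> Tb Bb; apply: bounded_operatorB; exact: bounded_operator_comp. Qed.

End bounded_operators.

Lemma cvg_partial_sum_fin (R : realType) (I : choiceType) (J : {fset I})
    (f : I -> R[i]) : (forall i, i \notin J -> f i = 0) ->
  partial_sum f @ totally --> \sum_(i <- J) f i.
Proof.
move=> f0; apply: cvg_near_cst; exists J => // K /= JK.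
rewrite (partial_sum_split f JK) !partial_sumE [X in _ + X]big_seq.
rewrite [X in _ + X]big1 ?addr0// => i; rewrite in_fsetD => /andP[iJ _].
exact: f0.
Qed.

(** * The pairing when the commutator is a partial isometry of finite rank *)

Section finite_rank_pairing.
Variables (R : realType) (A : cstarType R) (w : module_data A) (P : A).
Hypotheses (w_fredholm : even_fredholm_module w) (P_proj : projection P).
Local Notation H := (md_space w).
Let p : H -> H := md_rep P.
Let F : H -> H := @md_F _ _ w.
Let gamma : H -> H := @md_grading _ _ w.
Let C := commutator F p.
Implicit Types x y : H.

Let rep : star_representation (@md_rep _ _ w). Proof. by have [] := w_fredholm. Qed.
Let p_bounded : bounded_operator p. Proof. have [h _ _ _] := rep; exact: h. Qed.
Let p_lin : linear p. Proof. exact: p_bounded.1. Qed.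
Let F_self : self_adjoint F. Proof. by have [_ []] := w_fredholm. Qed.
Let F_lin : linear F. Proof. exact: F_self.1.1. Qed.
Let gamma_self : self_adjoint gamma. Proof. by have [_ _ _ []] := w_fredholm. Qed.
Let gammaK x : gamma (gamma x) = x. Proof. by have [_ _ _ []] := w_fredholm. Qed.

Let pp x : p (p x) = p x.
Proof. by rewrite /p -(repM rep) P_proj.2. Qed.

Let p_self x y : inner (p x) y = inner x (p y).
Proof. by rewrite /p -(rep_star rep) P_proj.1. Qed.

Let C_bounded : bounded_operator C.
Proof. by apply: bounded_commutator => //; case: F_self. Qed.

Let C_lin : linear C. Proof. exact: C_bounded.1. Qed.

Let C_skew x y : inner (C x) y = - inner x (C y).
Proof.
by rewrite /C /commutator innerBl innerBr F_self.2 !p_self F_self.2 opprB.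
Qed.

Let pC x : p (C x) = C x - C (p x).
Proof. by rewrite /C /commutator opB// !pp opprB [RHS]addrC addrA subrK. Qed.

(** [p [F, p] + [F, p] p = [F, p]], so [p] commutes with the square of the
commutator. *)
Let pCC x : p (C (C x)) = C (C (p x)).
Proof. by rewrite !pC opB// opprB addrC subrK. Qed.

(** If the commutator [C = [F, pi P]] satisfies [C^4 = - C^2], then [E = - C^2]
is an orthogonal projection commuting with [p = pi P], and
[C^(2n) = (-1)^n E] for [n > 0]: the sequence whose limit is the pairing is
constant. Its value is [Tr (gamma p E)], and the absolute value of [gamma p E]
is the projection [p E]; both traces are finite sums as soon as all but
finitely many vectors of some orthonormal basis are killed by [E]. *)
Lemma chern_pairing_finite_rank (I : choiceType) (b : I -> H) (J : {fset I}) :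
  orthonormal_basis b ->
  (forall x, C (C (C (C x))) = - C (C x)) ->
  (forall i, i \notin J -> C (C (b i)) = 0) ->
  chern_pairing w P (- \sum_(i <- J) inner (gamma (p (C (C (b i))))) (b i)).
Proof.
move=> b_onb C4 bJ; split=> //.
pose E x := - C (C x).
have CC_bounded : bounded_operator (fun x => C (C x)).
  exact: bounded_operator_comp.
have E_bounded : bounded_operator E.
  have -> : E = fun x => (-1) *: C (C x) by apply/funext => x; rewrite scaleN1r.
  exact: bounded_operatorZ.
have E_self x y : inner (E x) y = inner x (E y).
  by rewrite innerNl innerNr !C_skew opprK.
have EE x : E (E x) = E x by rewrite /E !opN// C4 opprK.
have pE x : p (E x) = E (p x) by rewrite /E opN// pCC.
have E0 i : i \notin J -> E (b i) = 0 by move=> /bJ; rewrite /E => ->; rewrite oppr0.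
have CCE x : C (C (E x)) = - E x by rewrite /E !opN// C4.
have dE n x : iter (2 * n.+1) C x = (-1) ^+ n.+1 *: E x.
  elim: n => [|n ih]; first by rewrite expr1 scaleN1r opprK.
  have -> : (2 * n.+2 = (2 * n.+1).+2)%N by rewrite mulnS.
  rewrite 2!iterS ih.
  by rewrite !opZ// CCE [in RHS]exprS -scalerA scaleN1r scalerN.
have signK n : (-1) ^+ n * ((-1) ^+ n)^*%R = 1 :> R[i].
  by rewrite rmorphXn rmorphN1 -exprMn mulrNN mulr1 expr1n.
have abs_proj (T B : H -> H) : bounded_operator T -> bounded_operator B ->
    (forall x y, inner (B x) y = inner x (B y)) -> (forall x, B (B x) = B x) ->
    (forall x y, inner (T x) (T y) = inner (B x) y) ->
    (forall i, i \notin J -> B (b i) = 0) -> trace_class T.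
  move=> Tb Bb B_self BB TB B0; split=> //; exists B, I, b; split=> //.
    split; last by move=> x y; rewrite BB TB.
    by split=> // x; rewrite -BB B_self; exact: (dot_ge0 inner).
  apply/cvg_ex; exists (\sum_(i <- J) inner (B (b i)) (b i)).
  by apply: cvg_partial_sum_fin => i /B0 ->; rewrite inner0l.
have bounded_gpE n : bounded_operator (fun x => gamma (p ((-1) ^+ n *: E x))).
  apply: bounded_operator_comp; first exact: gamma_self.1.
  by apply: bounded_operator_comp => //; exact: bounded_operatorZ.
have gpZ k y : gamma (p (k *: y)) = k *: gamma (p y).
  by rewrite (opZ _ _ p_lin) (opZ _ _ gamma_self.1.1).
exists (fun n => (-1) ^+ n * \sum_(i <- J) inner (gamma (p (E (b i)))) (b i)).
split.
  exists 1%N => // -[//|n] _.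
  rewrite /mkset -/F -/p -/gamma -/C.
  have -> : iter (2 * n.+1) C = fun x => (-1) ^+ n.+1 *: E x.
    by apply/funext => x; exact: dE.
  split; last split.
  - apply: (abs_proj _ E) => //; first exact: bounded_operatorZ.
    by move=> x y; rewrite innerZl innerZr mulrA signK mul1r -E_self EE.
  - apply: (abs_proj _ (fun x => p (E x))) => //.
    + exact: bounded_operator_comp.
    + by move=> x y; rewrite p_self E_self -pE.
    + by move=> x; rewrite -pE pp EE.
    + move=> x y; rewrite -gamma_self.2 gammaK !opZ// innerZl innerZr.
      by rewrite mulrA signK mul1r -p_self pp -E_self -pE EE.
    + by move=> i /E0 ->; rewrite op0.
  - exists I, b; split=> //; rewrite mulr_sumr.
    under eq_bigr do rewrite -innerZl -gpZ.
    apply: cvg_partial_sum_fin => i /E0 ->.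
    by rewrite scaler0 !op0 ?inner0l//; exact: gamma_self.1.1.
apply: cvg_near_cst; near=> n; rewrite mulrA -exprMn mulrNN mulr1 expr1n mul1r.
rewrite -sumrN; apply: eq_bigr => i _.
by rewrite /E !opN ?innerNl//; exact: gamma_self.1.1.
Unshelve. all: by end_near. Qed.

End finite_rank_pairing.

(** * Orthonormal bases *)

Section orthonormal_bases.
Variable R : realType.

Lemma dense_closureT (H : hilbertType R) (B : set H) :
  (forall x (e : R[i]), 0 < e -> exists2 y, B y & `|x - y| < e) ->
  closure B = setT.
Proof.
move=> dense; apply/seteqP; split=> // x _ U; rewrite -nbhs_ballE => -[e /= e0 eU].
have [y By xy] := dense x e e0; exists y; split=> //; apply: eU.
by rewrite -ball_normE.
Qed.

Lemma closureT_dense (H : hilbertType R) (B : set H) : closure B = setT ->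
  forall x (e : R[i]), 0 < e -> exists2 y, B y & `|x - y| < e.
Proof.
move=> BT x e e0; have : closure B x by rewrite BT.
move=> /(_ (ball x e)) [|y [By]]; first exact: nbhsx_ballx.
by rewrite -ball_normE /=; exists y.
Qed.

Lemma orthonormal_basis_complex : orthonormal_basis (fun _ : unit => 1 : R[i]).
Proof.
split=> [[] []|]; first by rewrite /inner/= /complex_dot rmorph1 mulr1.
apply: dense_closureT => x e e0; exists x; last by rewrite subrr normr0.
by exists [:: tt], (fun=> x); rewrite big_seq1 [RHS]mulr1.
Qed.

Lemma hsum_innerE (H K : hilbertType R) (x y : hsum H K) :
  inner x y = inner x.1 y.1 + inner x.2 y.2.
Proof. by []. Qed.

Definition hsum_basis (H K : hilbertType R) (I J : choiceType) (b : I -> H)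
    (c : J -> K) (i : I + J) : hsum H K :=
  match i with inl i => (b i, 0) | inr j => (0, c j) end.

Lemma hsum_fst_sum (H K : hilbertType R) (I : Type) (s : seq I)
    (f : I -> hsum H K) : (\sum_(i <- s) f i).1 = \sum_(i <- s) (f i).1.
Proof. by elim: s => [|i s ih]; rewrite ?big_nil// !big_cons -ih. Qed.

Lemma hsum_snd_sum (H K : hilbertType R) (I : Type) (s : seq I)
    (f : I -> hsum H K) : (\sum_(i <- s) f i).2 = \sum_(i <- s) (f i).2.
Proof. by elim: s => [|i s ih]; rewrite ?big_nil// !big_cons -ih. Qed.

Lemma orthonormal_basis_hsum (H K : hilbertType R) (I J : choiceType)
    (b : I -> H) (c : J -> K) : orthonormal_basis b -> orthonormal_basis c ->
  orthonormal_basis (hsum_basis b c).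
Proof.
move=> [b1 bT] [c1 cT]; split.
  by move=> [i|i] [j|j]; rewrite hsum_innerE /= ?inner0l ?inner0r ?addr0 ?add0r//.
apply: dense_closureT => x e e0; have e2 : 0 < e / 2 by rewrite divr_gt0.
have [_ [s [k ->]] xs] := closureT_dense bT x.1 e2.
have [_ [t [l ->]] xt] := closureT_dense cT x.2 e2.
pose m (i : I + J) := match i with inl i => k i | inr j => l j end.
exists (\sum_(i <- [seq inl i | i <- s] ++ [seq inr j | j <- t])
  m i *: hsum_basis b c i); first by exists (map inl s ++ map inr t), m.
apply: le_lt_trans (hsum_norm_le _) _; rewrite [ltRHS]splitr /=.
rewrite hsum_fst_sum hsum_snd_sum !big_cat !big_map /=.
rewrite (eq_bigr (fun i => k i *: b i))//.
rewrite (_ : \sum_(i <- t) _ = 0) ?addr0; last first.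
  by rewrite big1// => i _; rewrite scaler0.
rewrite [X in _ - (X + _)]big1 => [|i _]; last by rewrite scaler0.
by rewrite add0r ltrD.
Qed.

Variable I : choiceType.
Implicit Types x y : l2 R I.

Lemma inner_l2_delta x i : inner x (l2_delta R i) = x i.
Proof.
apply: (@l2_dot_unique R I).
have -> : x i = \sum_(j <- [fset i]%fset) x j * (l2_delta R i j)^*%R.
  by rewrite big_seq_fset1 /= eqxx rmorph1 mulr1.
apply: cvg_partial_sum_fin => j; rewrite in_fset1 /= => /negbTE ->.
by rewrite rmorph0 mulr0.
Qed.

Lemma l2_sumE (T : Type) (s : seq T) (f : T -> l2 R I) i :
  (\sum_(j <- s) f j) i = \sum_(j <- s) f j i.
Proof. by elim: s => [|j s ih]; rewrite ?big_nil// !big_cons -ih. Qed.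

Lemma l2_truncE x (J : {fset I}) i :
  (\sum_(j <- J) x j *: l2_delta R j) i = if i \in J then x i else 0.
Proof.
rewrite l2_sumE; under eq_bigr do rewrite l2ZE /=.
case: ifPn => iJ.
  rewrite (big_fsetD1 i)//= eqxx mulr1 big1_fset ?addr0// => j.
  by rewrite !inE eq_sym => /andP[/negbTE ->] _ _; rewrite mulr0.
rewrite big1_fset// => j jJ _; case: eqP => [ij|_]; last by rewrite mulr0.
by rewrite ij jJ in iJ.
Qed.

(** The distance from [x] to its truncation to a finite set [J] of indices is the
tail of the sum that defines [<x, x>]. *)
Lemma orthonormal_basis_l2 : orthonormal_basis (@l2_delta R I).
Proof.
split=> [i j|]; first by rewrite inner_l2_delta /= eq_sym.
apply: dense_closureT => x e e0.
have e20 : 0 < e ^+ 2 by rewrite exprn_gt0.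
have /cvgrPdist_lt/(_ _ e20) [J _ /(_ J (fsubset_refl J))] := @l2_dot_cvg R I x x.
set y := \sum_(j <- J) x j *: l2_delta R j => xJ.
have inner_y (z : l2 R I) : inner z y = \sum_(j <- J) z j * (x j)^*%R.
  rewrite linear_sum /=; apply: eq_bigr => j _.
  by rewrite innerZr inner_l2_delta mulrC.
exists y; first by exists (enum_fset J), x.
rewrite -(@ltr_pXn2r _ 2%N) ?nnegrE// ?(ltW e0)//.
(* [y] is the orthogonal projection of [x] on the span of the [delta_j]. *)
have xy : inner (x - y) y = 0.
  rewrite inner_y big1_fset// => j jJ _.
  have -> : (x - y) j = x j - y j by [].
  by rewrite l2_truncE jJ subrr mul0r.
rewrite inner_norm -(ger0_norm (dot_ge0 inner (x - y))).
suff -> : inner (x - y) (x - y) =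
  l2_dot x x - partial_sum (fun i => x i * (x i)^*%R) J by [].
rewrite innerBr xy subr0 innerBl (dotC inner y) inner_y partial_sumE rmorph_sum.
by congr (_ - _); apply: eq_bigr => j _; rewrite rmorphM /= conjCK mulrC.
Qed.

End orthonormal_bases.

(** * Operators on a sum of two copies of a space *)

Section blocks.
Variables (R : realType) (H : hilbertType R).
Implicit Types (a b c d : H -> H).

Lemma bounded_operator0 : bounded_operator ((fun=> 0) : H -> H).
Proof.
split; first by move=> k x y; rewrite scaler0 addr0.
by exists 0 => x; rewrite normr0 mul0r.
Qed.

Lemma bounded_operator_id : bounded_operator (id : H -> H).
Proof. by split=> //; exists 1 => x; rewrite mul1r. Qed.

Lemma bounded_block a b c d : bounded_operator a -> bounded_operator b ->
  bounded_operator c -> bounded_operator d -> bounded_operator (block_op a b c d).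
Proof.
move=> ab bb cb db; split.
  move=> k x y; rewrite /block_op /= ab.1 bb.1 cb.1 db.1.
  by congr pair; rewrite /= scalerDr addrACA.
have [M M0 aM] := bounded_operator_ge0 ab; have [N N0 bN] := bounded_operator_ge0 bb.
have [K K0 cK] := bounded_operator_ge0 cb; have [L L0 dL] := bounded_operator_ge0 db.
exists (M + N + (K + L)) => x; apply: le_trans (hsum_norm_le _) _ => /=.
have le (r : R) (s t : R[i]) : 0 <= r -> s <= r%:C * t -> t <= `|x| ->
    s <= r%:C * `|x|.
  by move=> r0 /le_trans h tx; apply: h; rewrite ler_wpM2l// lecR.
rewrite !rmorphD/= !mulrDl; apply: lerD.
  apply: le_trans (ler_normD _ _) _; apply: lerD.
    exact: le (aM _) (hsum_norm1 x).
  exact: le (bN _) (hsum_norm2 x).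
apply: le_trans (ler_normD _ _) _; apply: lerD.
  exact: le (cK _) (hsum_norm1 x).
exact: le (dL _) (hsum_norm2 x).
Qed.

Lemma block_self_adjoint a b c d : self_adjoint a -> self_adjoint d ->
  bounded_operator b -> bounded_operator c ->
  (forall x y, inner (b x) y = inner x (c y)) ->
  self_adjoint (block_op a b c d).
Proof.
move=> [ab a_self] [db d_self] bb cb bc; split; first exact: bounded_block.
have cbE x y : inner (c x) y = inner x (b y).
  by rewrite (dotC inner) -bc -(dotC inner).
by move=> x y; rewrite !hsum_innerE /= !innerDl !innerDr a_self d_self bc cbE; ring.
Qed.

Lemma self_adjoint0 : self_adjoint ((fun=> 0) : H -> H).
Proof. by split=> [|x y]; [exact: bounded_operator0|rewrite inner0l inner0r]. Qed.

Lemma grading_self_adjoint : self_adjoint (@block_grading R H).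
Proof.
apply: block_self_adjoint; try exact: bounded_operator0.
- by split=> //; exact: bounded_operator_id.
- split=> [|x y]; last by rewrite innerNl innerNr.
  rewrite (_ : -%R = fun x : H => (-1) *: x).
    by apply: bounded_operatorZ; exact: bounded_operator_id.
  by apply/funext => x; rewrite scaleN1r.
- by move=> x y; rewrite inner0l inner0r.
Qed.

Lemma gradingE (x : hsum H H) : block_grading x = (x.1, - x.2).
Proof. by rewrite /block_grading /block_op addr0 add0r. Qed.

Lemma gradingK (x : hsum H H) : block_grading (block_grading x) = x.
Proof. by rewrite !gradingE /= opprK; case: x. Qed.

End blocks.

(** * The module of a character *)

Section trivial_module.
Variables (R : realType) (A : cstarType R) (phi : {lrmorphism A -> R[i]}).
Hypothesis phi_star : forall a, phi (star a) = (phi a)^*%R.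

Let repE a (x : hsum R[i] R[i]) : @md_rep _ _ (w0 phi) a x = (phi a * x.1, 0).
Proof. by rewrite /= /block_op !addr0. Qed.

Let FE (x : hsum R[i] R[i]) : @md_F _ _ (w0 phi) x = (x.2, x.1).
Proof. by rewrite /= /block_op addr0 add0r. Qed.

Let finite_netsC (T : hsum R[i] R[i] -> hsum R[i] R[i]) :
  bounded_operator T -> has_finite_nets T.
Proof.
move=> [_ [M TM]].
have -> : T = fun x => (T x).1 *: (1, 0) + (T x).2 *: (0, 1).
  apply/funext => x; case: (T x) => u v.
  by congr pair; rewrite /= scaler0 ?addr0 ?add0r [RHS]mulr1.
apply: finite_netsD; apply: (finite_nets_rank1 (K := M)) => x.
  exact: le_trans (hsum_norm1 _) (TM x).
exact: le_trans (hsum_norm2 _) (TM x).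
Qed.

Lemma w0_fredholm : even_fredholm_module (w0 phi).
Proof.
have b0 := @bounded_operator0 R R[i].
have rep_bounded a : bounded_operator (@md_rep _ _ (w0 phi) a).
  apply: bounded_block => //.
  exact: (bounded_operatorZ (phi a) (@bounded_operator_id R R[i])).
have F_self : self_adjoint (@md_F _ _ (w0 phi)).
  apply: block_self_adjoint => //; try exact: self_adjoint0;
    exact: bounded_operator_id.
split.
- split=> //.
  + move=> k a b x; rewrite !repE linearP; congr pair; last by rewrite /= scaler0 addr0.
    by rewrite /= mulrDl -scalerAl.
  + by move=> a b x; rewrite !repE rmorphM /= mulrA.
  + move=> a x y; rewrite !repE !hsum_innerE /= inner0l inner0r !addr0.
    rewrite phi_star -[LHS]/(_ * _ * _) -[RHS]/(_ * (_ * _)^*%R).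
    by rewrite rmorphM/= mulrCA mulrA.
- by split=> // x; rewrite !FE; case: x.
- move=> a; have Cb : bounded_operator
      (commutator (@md_F _ _ (w0 phi)) (@md_rep _ _ (w0 phi) a)).
    by apply: bounded_commutator => //; case: F_self.
  by apply: finite_nets_compact => //; exact: finite_netsC.
- split; first exact: (@grading_self_adjoint R R[i]).
  exact: (@gradingK R R[i]).
- split.
    move=> a x; rewrite -[LHS]/(block_grading (@md_rep _ _ (w0 phi) a x)).
    rewrite -[RHS]/(@md_rep _ _ (w0 phi) a (block_grading x)) !repE !gradingE /=.
    by rewrite oppr0.
  move=> x; rewrite -[LHS]/(@md_F _ _ (w0 phi) (block_grading x)).
  rewrite -[RHS]/(- block_grading (@md_F _ _ (w0 phi) x)) !FE !gradingE /=.
  by congr pair; rewrite /= opprK.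
Qed.

(** For a projection on which the character is 1, [-C^2] is the identity of the
plane, and the trace of [gamma pi(P)] is that of the rank one operator
[pi(P)]. *)
Lemma w0_pairing P : projection P -> phi P = 1 -> chern_pairing (w0 phi) P 1.
Proof.
move=> Pproj P1.
have CE x : commutator (@md_F _ _ (w0 phi)) (@md_rep _ _ (w0 phi) P) x = (- x.2, x.1).
  rewrite /commutator !(repE, FE) P1 !mul1r.
  by congr pair; rewrite /= ?sub0r ?subr0.
have C_onb := orthonormal_basis_complex R; have b_onb := orthonormal_basis_hsum C_onb C_onb.
pose J : {fset unit + unit} := [fset inl tt; inr tt]%fset.
have JT i : i \in J by case: i => [[]|[]]; rewrite !inE.
have := @chern_pairing_finite_rank R A (w0 phi) P w0_fredholm Pproj _ _ J b_onb.
rewrite (_ : - _ = 1).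
  apply; first by move=> x; rewrite !CE /= opprK; congr pair; rewrite /= opprK.
  by move=> i; rewrite JT.
rewrite big_fsetU1 ?inE// big_seq_fset1 !CE !repE P1 [md_grading _]/= !gradingE.
rewrite !hsum_innerE /= !mul1r !oppr0 !inner0l !inner0r innerNl !addr0.
rewrite [complex_dot 0 1]mul0r !addr0 opprK.
by rewrite /inner/= /complex_dot rmorph1 mulr1.
Qed.

End trivial_module.

(** * Continuity of the commutator with a represented element *)

Section commutators_with_representations.
Variables (R : realType) (A : cstarType R) (H : hilbertType R).
Variables (pi : A -> H -> H) (pi_rep : star_representation pi).
Variables (T : H -> H) (T_bounded : bounded_operator T).
Implicit Types (a b : A) (x : H).

Lemma commutator_repD a b x :
  commutator T (pi (a + b)) x = commutator T (pi a) x + commutator T (pi b) x.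
Proof.
by rewrite /commutator !(repD pi_rep) (opD _ _ T_bounded.1) opprD addrACA.
Qed.

Lemma commutator_repZ (k : R[i]) a x :
  commutator T (pi (k *: a)) x = k *: commutator T (pi a) x.
Proof. by rewrite /commutator !(repZ pi_rep) (opZ _ _ T_bounded.1) scalerBr. Qed.

Lemma commutator_rep0 x : commutator T (pi 0) x = 0.
Proof. by rewrite /commutator !(rep0 pi_rep) (op0 T_bounded.1) subrr. Qed.

Lemma commutator_repB a b x :
  commutator T (pi (a - b)) x = commutator T (pi a) x - commutator T (pi b) x.
Proof. by rewrite commutator_repD -scaleN1r commutator_repZ scaleN1r. Qed.

Lemma commutator_rep_le : exists2 K : R, 0 < K &
  forall a x, `|commutator T (pi a) x| <= K%:C * cnorm a * `|x|.
Proof.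
have [M M0 TM] := bounded_operator_ge0 T_bounded.
exists (1 + (M * 2 + M * 2)); first by rewrite ltr_pwDl// addr_ge0// mulr_ge0.
move=> a x; apply: (@le_trans _ _ ((M * 2 + M * 2)%:C * cnorm a * `|x|)).
  rewrite rmorphD/= -mulrA mulrDl (le_trans (ler_normB _ _))// lerD//.
    apply: le_trans (TM _) _; rewrite rmorphM/= rmorph_nat -mulrA.
    by rewrite ler_wpM2l ?lecR// mulrA rep_norm_le.
  apply: le_trans (rep_norm_le pi_rep _ _) _; rewrite rmorphM/= rmorph_nat.
  rewrite [leRHS](_ : _ = 2 * cnorm a * (M%:C * `|x|)); last by ring.
  by rewrite ler_wpM2l// mulr_ge0// cnorm_ge0.
by rewrite !ler_wpM2r ?cnorm_ge0// lecR lerDr.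
Qed.

(** By this and the next lemma, compactness or vanishing of [[T, pi a]] need only
be checked on a dense set of elements [a], such as the span of a group. *)
Lemma finite_nets_commutator_limit a :
  (forall e : R[i], 0 < e -> exists b, cnorm (a - b) < e /\
    has_finite_nets (commutator T (pi b))) ->
  has_finite_nets (commutator T (pi a)).
Proof.
have [K K0 TK] := commutator_rep_le.
move=> lim; apply: finite_nets_limit => e e0.
have [|b [ab bnets]] := lim (e / K)%:C; first by rewrite ltcR divr_gt0.
exists (commutator T (pi b)); split=> // x; rewrite -commutator_repB.
apply: le_trans (TK _ _) _; rewrite ler_wpM2r// mulrC.
rewrite -ler_pdivlMr ?ltcR// -fmorphV -rmorphM/=; exact: ltW.
Qed.

Lemma commutator_limit0 a :
  (forall e : R[i], 0 < e -> exists b, cnorm (a - b) < e /\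
    forall x, commutator T (pi b) x = 0) ->
  forall x, commutator T (pi a) x = 0.
Proof.
have [K K0 TK] := commutator_rep_le.
move=> lim x; apply/eqP; rewrite -normr_le0; apply/ler_addgt0Pr => e e0.
rewrite add0r; have x0 : 0 < K%:C * (1 + `|x|) by rewrite mulr_gt0 ?ltcR// ltr_pwDl.
have [|b [ab b0]] := lim (e / (K%:C * (1 + `|x|))); first by rewrite divr_gt0.
rewrite -[commutator _ _ _]subr0 -(b0 x) -commutator_repB; apply: le_trans (TK _ _) _.
move: (ltW ab); rewrite ler_pdivlMr// => /le_trans h.
apply: {h}(le_trans _ (h _ (lexx _))); rewrite mulrAC mulrC ler_wpM2l ?cnorm_ge0//.
by rewrite ler_wpM2l ?lecR ?(ltW K0)// lerDr.
Qed.

End commutators_with_representations.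

(** * The representation of the dihedral group on two copies of l2(Z) *)

Section sign_operator.
Variable R : realType.
Implicit Types x y : l2Z R.

Lemma zsignK n : zsign R n * zsign R n = 1.
Proof. by rewrite /zsign; case: ifP => _; rewrite ?mulrNN mulr1. Qed.

Lemma zsign_conj n : (zsign R n)^*%R = zsign R n.
Proof. by rewrite /zsign; case: ifP => _; rewrite ?rmorphN rmorph1. Qed.

Lemma l2_signK x : l2_sign (l2_sign x) = x.
Proof. by apply: l2_ext => n /=; rewrite mulrA zsignK mul1r. Qed.

Lemma l2_sign_inner x y : inner (l2_sign x) y = inner x (l2_sign y).
Proof.
suff : l2_dot (l2_sign x) y = l2_dot x (l2_sign y) by [].
rewrite /l2_dot; congr sum; apply/funext => n.
by rewrite /= rmorphM /= zsign_conj mulrCA mulrA.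
Qed.

Lemma l2_sign_bounded : bounded_operator (@l2_sign R).
Proof.
split.
  by move=> k x y; apply: l2_ext => n; rewrite l2DE l2ZE /= mulrDr mulrCA.
exists 1 => x; rewrite mul1r -(@ler_pXn2r _ 2%N)// ?nnegrE//.
by rewrite !inner_norm l2_sign_inner l2_signK.
Qed.

End sign_operator.

Section finite_support.
Variables (R : realType) (I : choiceType).

Lemma finite_nets_support (T : hsum (l2 R I) (l2 R I) -> hsum (l2 R I) (l2 R I))
    (J : {fset I}) : bounded_operator T ->
  (forall x i, i \notin J -> (T x).1 i = 0 /\ (T x).2 i = 0) ->
  has_finite_nets T.
Proof.
move=> [_ [M TM]] T0.
have -> : T = fun x => \sum_(j <- J) (T x).1 j *: (l2_delta R j, 0) +
                       \sum_(j <- J) (T x).2 j *: (0, l2_delta R j).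
  apply/funext => x; rewrite [LHS]surjective_pairing; congr pair; apply: l2_ext => i.
    rewrite -[RHS]/(l2_fun _ i + l2_fun _ i) !hsum_fst_sum /=.
    rewrite [X in _ + X]l2_sumE [X in _ + X]big1 ?addr0 => [|j _].
      rewrite l2_truncE; case: ifPn => // iJ; exact: (T0 x i iJ).1.
    by rewrite /= scaler0.
  rewrite -[RHS]/(l2_fun _ i + l2_fun _ i) !hsum_snd_sum /=.
  rewrite [X in X + _]l2_sumE [X in X + _]big1 ?add0r => [|j _].
    rewrite l2_truncE; case: ifPn => // iJ; exact: (T0 x i iJ).2.
  by rewrite /= scaler0.
apply: finite_netsD; apply: (@finite_nets_sum _ _ _ _ _ M) => j x.
  exact: le_trans (l2_norm_coord _ _) (le_trans (hsum_norm1 _) (TM x)).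
exact: le_trans (l2_norm_coord _ _) (le_trans (hsum_norm2 _) (TM x)).
Qed.

End finite_support.

Section coordinates.
Variable R : realType.
Implicit Types (x y : hsum (l2Z R) (l2Z R)) (m : int).

Lemma coordZ (k : R[i]) x m :
  (k *: x).1 m = k * x.1 m /\ (k *: x).2 m = k * x.2 m.
Proof.
have -> : (k *: x).1 = k *: (x.1 : l2 R int) by [].
have -> : (k *: x).2 = k *: (x.2 : l2 R int) by [].
by split; exact: l2ZE.
Qed.

Lemma coordN x m : (- x).1 m = - x.1 m /\ (- x).2 m = - x.2 m.
Proof. by []. Qed.

Lemma coordD x y m :
  (x + y).1 m = x.1 m + y.1 m /\ (x + y).2 m = x.2 m + y.2 m.
Proof.
have -> : (x + y).1 = (x.1 : l2 R int) + (y.1 : l2 R int) by [].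
have -> : (x + y).2 = (x.2 : l2 R int) + (y.2 : l2 R int) by [].
by split; exact: l2DE.
Qed.

Lemma coordB x y m :
  (x - y).1 m = x.1 m - y.1 m /\ (x - y).2 m = x.2 m - y.2 m.
Proof.
by rewrite (coordD x (- y) m).1 (coordD x (- y) m).2 (coordN y m).1 (coordN y m).2.
Qed.

Lemma coord_grading x m : (block_grading x).1 m = x.1 m /\
  (block_grading x).2 m = - x.2 m.
Proof. by rewrite gradingE. Qed.

Lemma pair_ext x y :
  (forall m, x.1 m = y.1 m /\ x.2 m = y.2 m) -> x = y.
Proof.
case: x y => [x x'] [y y'] /= xy.
by congr pair; apply: l2_ext => m; case: (xy m).
Qed.

End coordinates.

Definition int_ball (N : nat) : {fset int} :=
  [fset m in [seq i%:Z - N%:Z | i <- iota 0 (N + N).+1]]%fset.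

Lemma in_int_ball N (m : int) : (m \in int_ball N) = (absz m <= N)%N.
Proof.
rewrite in_fset; apply/mapP/idP => [[j]|mN].
  by rewrite mem_iota => jN ->; lia.
by exists (absz (m + N%:Z)); [rewrite mem_iota|]; lia.
Qed.

Section dihedral_module.
Variables (R : realType) (A : cstarType R) (u : dihedral -> A).
Hypothesis A_group_cstar : is_group_cstar u.
Variable pi : A -> hsum (l2Z R) (l2Z R) -> hsum (l2Z R) (l2Z R).
Hypothesis pi_rep : star_representation pi.
Hypothesis pi_transl : forall x, pi (u transl) x =
  block_op (@l2_shift R) (fun=> 0) (fun=> 0) (@l2_shift R) x.
Hypothesis pi_refl : forall x, pi (u refl) x =
  block_op (@l2_flip R) (fun=> 0) (fun=> 0) (fun y => - l2_flip y) x.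
Implicit Types (g : dihedral) (x : hsum (l2Z R) (l2Z R)) (m n : int).

Let F := @md_F _ _ (w1 pi).

Lemma group_mul m n b c : u (m, b) * u (n, c) =
  u (m + (if b then - n else n), b (+) c).
Proof. by have [[_ uM] _ _ _] := A_group_cstar; rewrite -uM. Qed.

Lemma group_one : u (0, false) = 1.
Proof. by have [[u1 _] _ _ _] := A_group_cstar; rewrite -u1. Qed.

(** The action of [g^-1] on the integers, through which [g] acts on functions. *)
Definition dihedral_actV g m : int := if g.2 then g.1 - m else m - g.1.

Lemma rep_one x : pi 1 x = x.
Proof.
rewrite -group_one (_ : u (0, false) = u refl * u refl); last first.
  by rewrite group_mul/= oppr0 addr0.
rewrite (repM pi_rep) !pi_refl /block_op /= !addr0 !add0r.
by case: x => x y; congr pair; apply: l2_ext => n; rewrite /= ?opprK.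
Qed.

Let pi_translE x m : (pi (u transl) x).1 m = x.1 (m - 1) /\
  (pi (u transl) x).2 m = x.2 (m - 1).
Proof. by rewrite pi_transl /block_op /= addr0 add0r. Qed.

Let pi_power n x m : (pi (u (n, false)) x).1 m = x.1 (m - n) /\
  (pi (u (n, false)) x).2 m = x.2 (m - n).
Proof.
elim/int_ind: n m => [m|n ih m|n ih m].
- by rewrite group_one rep_one subr0.
- have -> : u (n.+1%:Z, false) = u transl * u (n%:Z, false).
    by rewrite group_mul/= -intS.
  rewrite (repM pi_rep) !(pi_translE _ _).1 !(pi_translE _ _).2.
  by rewrite !(ih _).1 !(ih _).2 intS opprD addrA.
- have e : u transl * u (- n.+1%:Z, false) = u (- n%:Z, false).
    by rewrite group_mul/= intS opprD addrA subrr add0r.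
  have := ih (m + 1); rewrite -e (repM pi_rep).
  rewrite !(pi_translE _ _).1 !(pi_translE _ _).2 addrK => -[-> ->].
  by rewrite intS !opprK addrA.
Qed.

Lemma rep_dihedralE g x m : (pi (u g) x).1 m = x.1 (dihedral_actV g m) /\
  (pi (u g) x).2 m = (-1) ^+ g.2 * x.2 (dihedral_actV g m).
Proof.
case: g => n [] /=; last by rewrite /dihedral_actV /= expr0 mul1r; exact: pi_power.
have -> : u (n, true) = u (n, false) * u refl by rewrite group_mul/= addr0.
rewrite (repM pi_rep) !(pi_power _ _ _).1 !(pi_power _ _ _).2 pi_refl.
rewrite /block_op /= addr0 add0r /dihedral_actV /= opprB; split=> //.
by rewrite expr1 mulN1r -[LHS]/(- x.2 (- (m - n))) opprB.
Qed.

Let F_formula x m : (F x).1 m = 'i%C * (zsign R m * x.2 m) /\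
  (F x).2 m = - 'i%C * (zsign R m * x.1 m).
Proof. by rewrite /F /= /block_op /= add0r addr0. Qed.

(** The opposite signs of the two blocks of [pi(e)] turn the commutator of [sign]
with a reflection into an anticommutator. So the sign of [g^-1 m] is compared
with [(-1)^b] times the sign of [m], where [g = (n, b)]. *)
Lemma commutator_dihedralE g x m (k := dihedral_actV g m) :
  (commutator F (pi (u g)) x).1 m =
    'i%C * ((-1) ^+ g.2 * zsign R m - zsign R k) * x.2 k /\
  (commutator F (pi (u g)) x).2 m =
    'i%C * ((-1) ^+ g.2 * zsign R k - zsign R m) * x.1 k.
Proof.
have [e1 e2] := F_formula (pi (u g) x) m; have [h1 h2] := rep_dihedralE g (F x) m.
have [i1 i2] := F_formula x k; have [j1 j2] := rep_dihedralE g x m.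
split; rewrite /commutator.
  by rewrite (coordB _ _ m).1 e1 h1 j2 i1 -/k; ring.
by rewrite (coordB _ _ m).2 e2 h2 j1 i2 -/k; ring.
Qed.

Let F_self : self_adjoint F.
Proof.
apply: block_self_adjoint; try exact: self_adjoint0;
  try by apply: bounded_operatorZ; exact: l2_sign_bounded.
move=> x y; rewrite innerZl innerZr l2_sign_inner; congr (_ * _).
by apply/eqP; rewrite eq_complex /= ?oppr0 ?opprK !eqxx.
Qed.

Let FK x : F (F x) = x.
Proof.
have ii : 'i%C * 'i%C = -1 :> R[i] by rewrite -expr2 sqr_i.
apply: pair_ext => m; have [e1 e2] := F_formula (F x) m.
rewrite e1 e2 (F_formula x m).1 (F_formula x m).2.
have cancel (v : R[i]) : - ('i%C * 'i%C) * (zsign R m * zsign R m) * v = v.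
  by rewrite ii zsignK opprK !mul1r.
by split; rewrite -[RHS]cancel; ring.
Qed.

Let F_bounded : bounded_operator F. Proof. exact: F_self.1. Qed.

(** [g^-1] differs from its linear part by a translation of length [|g.1|],
which cannot change the sign of a larger integer. Therefore [[F, pi (u g)]] has finite
rank. *)
Let commutator_support g m : (absz g.1 < absz m)%N ->
  (-1) ^+ g.2 * zsign R m - zsign R (dihedral_actV g m) = 0 /\
  (-1) ^+ g.2 * zsign R (dihedral_actV g m) - zsign R m = 0.
Proof.
case: g => n [] /= nm; rewrite /dihedral_actV /zsign /=.
  case: ifP; case: ifP => h1 h2; rewrite ?expr1; try lia; split; ring.
case: ifP; case: ifP => h1 h2; rewrite ?expr0; try lia; split; ring.
Qed.

Let finite_nets_monomial (k : R[i]) g :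
  has_finite_nets (commutator F (pi (k *: u g))).
Proof.
apply: (@finite_nets_support R int _ (int_ball (absz g.1))) => [|x m].
  apply: bounded_commutator => //; have [h _ _ _] := pi_rep; exact: h.
rewrite in_int_ball -ltnNge => /commutator_support[z1 z2].
rewrite !(commutator_repZ pi_rep F_bounded).
have [c1 c2] := commutator_dihedralE g x m.
by rewrite (coordZ k _ m).1 (coordZ k _ m).2 c1 c2 z1 z2 !mulr0 !mul0r mulr0.
Qed.

(** The commutators with the group elements have finite rank, and those elements
span a dense subspace. *)
Let finite_nets_commutator a : has_finite_nets (commutator F (pi a)).
Proof.
apply: finite_nets_commutator_limit => // e e0.
have [_ _ dense _] := A_group_cstar; have [s [c sc]] := dense a e e0.
exists (\sum_(g <- s) c g *: u g); split=> // {sc}.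
elim: s => [|g s ih].
  rewrite big_nil (_ : commutator _ _ = fun=> 0); first exact: finite_nets0.
  by apply/funext => x; exact: commutator_rep0.
rewrite big_cons (_ : commutator _ _ = fun x => commutator F (pi (c g *: u g)) x +
  commutator F (pi (\sum_(h <- s) c h *: u h)) x).
  exact: finite_netsD (finite_nets_monomial (c g) g) ih.
by apply/funext => x; exact: commutator_repD.
Qed.

Let grading_commutes a x :
  commutator (@block_grading R (l2Z R)) (pi a) x = 0.
Proof.
have gamma_bounded := (@grading_self_adjoint R (l2Z R)).1.
apply: commutator_limit0 => // {x} e e0.
have [_ _ dense _] := A_group_cstar; have [s [c sc]] := dense a e e0.
exists (\sum_(g <- s) c g *: u g); split=> // x {sc}.
elim: s => [|g s ih]; first by rewrite big_nil commutator_rep0.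
rewrite big_cons commutator_repD// ih addr0 commutator_repZ//.
suff -> : commutator (@block_grading R (l2Z R)) (pi (u g)) x = 0 by rewrite scaler0.
apply/eqP; rewrite subr_eq0; apply/eqP; apply: pair_ext => m.
rewrite (coord_grading _ m).1 (coord_grading _ m).2.
have [h1 h2] := rep_dihedralE g x m; rewrite h1 h2.
have [h3 h4] := rep_dihedralE g (block_grading x) m; rewrite h3 h4.
by rewrite (coord_grading _ _).1 (coord_grading _ _).2 mulrN.
Qed.

Lemma w1_fredholm : even_fredholm_module (w1 pi).
Proof.
split=> //.
- move=> a; apply: finite_nets_compact; last exact: finite_nets_commutator.
  apply: bounded_commutator => //; have [h _ _ _] := pi_rep; exact: h.
- by split; [exact: grading_self_adjoint|exact: gradingK].
- split.
    by move=> a x; apply/eqP; rewrite -subr_eq0; apply/eqP; exact: grading_commutes.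
  move=> x; rewrite -[LHS]/(F (block_grading x)) -[RHS]/(- block_grading (F x)).
  apply: pair_ext => m; rewrite (coordN _ m).1 (coordN _ m).2.
  have [f1 f2] := F_formula (block_grading x) m; rewrite f1 f2.
  rewrite !(coord_grading _ m).1 !(coord_grading _ m).2.
  have [f3 f4] := F_formula x m; rewrite f3 f4.
  by split; ring.
Qed.

End dihedral_module.

(** * The pairings of the module of the sign operator *)

Section pairings.
Variables (R : realType) (A : cstarType R) (u : dihedral -> A).
Hypothesis A_group_cstar : is_group_cstar u.

Lemma star_reflection k : star (u (k, true)) = u (k, true).
Proof. by have [_ uV _ _] := A_group_cstar; rewrite uV. Qed.

Lemma reflection_projection k : projection (2^-1 *: (1 + u (k, true))).
Proof.
split; first by rewrite starZ starD star1 star_reflection fmorphV/= conjC_nat.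
rewrite -scalerAl -scalerAr scalerA mulrDl mul1r mulrDr mulr1.
rewrite (group_mul A_group_cstar) /= subrr (group_one A_group_cstar).
rewrite [u _ + 1]addrC.
have -> : 1 + u (k, true) + (1 + u (k, true)) = 2 *: (1 + u (k, true)).
  by rewrite scaler_nat mulr2n.
rewrite scalerA; congr (_ *: _).
by field.
Qed.

Lemma projection1 : projection (1 : A).
Proof. by split; [exact: star1|exact: mulr1]. Qed.

Variable pi : A -> hsum (l2Z R) (l2Z R) -> hsum (l2Z R) (l2Z R).
Hypothesis pi_rep : star_representation pi.
Hypothesis pi_transl : forall x, pi (u transl) x =
  block_op (@l2_shift R) (fun=> 0) (fun=> 0) (@l2_shift R) x.
Hypothesis pi_refl : forall x, pi (u refl) x =
  block_op (@l2_flip R) (fun=> 0) (fun=> 0) (fun y => - l2_flip y) x.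
Implicit Types (x : hsum (l2Z R) (l2Z R)) (m k : int).

Let F := @md_F _ _ (w1 pi).

Let w1_even : even_fredholm_module (w1 pi).
Proof. exact: (w1_fredholm A_group_cstar pi_rep pi_transl pi_refl). Qed.

Let F_bounded : bounded_operator F.
Proof. by have [_ [[]]] := w1_even. Qed.

Let basis := hsum_basis (@l2_delta R int) (@l2_delta R int).

Let basis_onb : orthonormal_basis basis.
Proof. by apply: orthonormal_basis_hsum; exact: orthonormal_basis_l2. Qed.

Let commutator_one x : commutator F (pi 1) x = 0.
Proof.
by rewrite /commutator !(rep_one A_group_cstar pi_rep pi_refl) subrr.
Qed.

Lemma w1_pairing_one : chern_pairing (w1 pi) 1 0.
Proof.
have := @chern_pairing_finite_rank R A (w1 pi) 1 w1_even projection1 _ basis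
  fset0 basis_onb.
rewrite big_seq_fset0 oppr0; apply; first by move=> x; rewrite !commutator_one oppr0.
by move=> i _; rewrite !commutator_one.
Qed.

Section reflection.
Variable k : int.
Let P : A := 2^-1 *: (1 + u (k, true)).
Let C := commutator F (pi P).
(** Up to sign, the indicator of the integers that [m |-> k - m] keeps on the same
side of the origin, 0 being on the positive side. *)
Let c m : R[i] := (zsign R m + zsign R (k - m)) / 2.

Let c_reflect m : c (k - m) = c m.
Proof. by rewrite /c opprB addrCA subrr addr0 addrC. Qed.

Let c_sqr_idem m : c m * c m * (c m * c m) = c m * c m.
Proof. by rewrite /c /zsign; case: ifP => _; case: ifP => _; field. Qed.

Let c_outside m : (absz k < absz m)%N -> c m = 0.
Proof.
rewrite /c /zsign => km; case: ifP; case: ifP => h1 h2; try lia.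
  by rewrite subrr mul0r.
by rewrite addNr mul0r.
Qed.

Let c_half m : k - m = m -> c m * c m = 1.
Proof. by rewrite /c /zsign => ->; case: ifP => _; field. Qed.

Let CE x m : (C x).1 m = - 'i%C * c m * x.2 (k - m) /\
  (C x).2 m = - 'i%C * c m * x.1 (k - m).
Proof.
rewrite /C /P (commutator_repZ pi_rep F_bounded) (commutator_repD pi_rep F_bounded).
rewrite commutator_one add0r.
have [h1 h2] := commutator_dihedralE A_group_cstar pi_rep pi_transl pi_refl (k, true) x m.
rewrite (coordZ _ _ m).1 (coordZ _ _ m).2 h1 h2 /dihedral_actV /= expr1 /c.
by split; field.
Qed.

Let CCE x m : (C (C x)).1 m = - (c m * c m) * x.1 m /\
  (C (C x)).2 m = - (c m * c m) * x.2 m.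
Proof.
have ii : 'i%C * 'i%C = -1 :> R[i] by rewrite -expr2 sqr_i.
have [h1 h2] := CE (C x) m; have [h3 h4] := CE x (k - m).
rewrite h1 h2 h3 h4 c_reflect opprB addrCA subrr addr0.
have sq v : - 'i%C * c m * (- 'i%C * c m * v) = 'i%C * 'i%C * (c m * c m * v) by ring.
by rewrite !sq ii !mulN1r !mulNr.
Qed.

Let C_fourth x : C (C (C (C x))) = - C (C x).
Proof.
have idem m (v : R[i]) : - (c m * c m) * (- (c m * c m) * v) = c m * c m * v.
  by rewrite -[in RHS]c_sqr_idem; ring.
apply: pair_ext => m; rewrite (coordN _ m).1 (coordN _ m).2.
have [h1 h2] := CCE (C (C x)) m; have [h3 h4] := CCE x m.
by rewrite h1 h2 h3 h4 !idem -!mulNr opprK.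
Qed.

Let piPE x m : (pi P x).1 m = (x.1 m + x.1 (k - m)) / 2 /\
  (pi P x).2 m = (x.2 m - x.2 (k - m)) / 2.
Proof.
rewrite /P (repZ pi_rep) (repD pi_rep) (rep_one A_group_cstar pi_rep pi_refl).
have [h1 h2] := rep_dihedralE A_group_cstar pi_rep pi_transl pi_refl (k, true) x m.
rewrite (coordZ _ _ m).1 (coordZ _ _ m).2 (coordD _ _ m).1 (coordD _ _ m).2 h1 h2.
by rewrite /dihedral_actV /= expr1 mulN1r; split; rewrite mulrC.
Qed.

Let diagonal_inl m :
  inner (block_grading (pi P (C (C (basis (inl m)))))) (basis (inl m)) =
  - (c m * c m) * (1 + (k - m == m)%:R) / 2.
Proof.
rewrite hsum_innerE /= inner0r addr0 inner_l2_delta (coord_grading _ m).1.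
rewrite (piPE _ m).1 (CCE _ m).1 (CCE _ (k - m)).1 c_reflect /= eqxx mulr1n; ring.
Qed.

Let diagonal_inr m :
  inner (block_grading (pi P (C (C (basis (inr m)))))) (basis (inr m)) =
  c m * c m * (1 - (k - m == m)%:R) / 2.
Proof.
rewrite hsum_innerE /= inner0r add0r inner_l2_delta (coord_grading _ m).2.
rewrite (piPE _ m).2 (CCE _ m).2 (CCE _ (k - m)).2 c_reflect /= eqxx mulr1n; ring.
Qed.

Let fixed_points : \sum_(m <- int_ball (absz k)) (k - m == m)%:R =
  (~~ odd (absz k))%:R :> R[i].
Proof.
have [k_odd|k_even] := boolP (odd (absz k)).
  by rewrite big1_fset// => m _ _; case: eqP => // km; lia.
pose h : int := (absz k)./2%:Z; pose m0 := if 0 <= k then h else - h.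
have m0P m : (k - m == m) = (m == m0).
  by rewrite /m0 /h; case: ifP => k0; apply/eqP/eqP; lia.
rewrite (big_fsetD1 m0) /= ?m0P ?eqxx; last first.
  by rewrite in_int_ball /m0 /h; case: ifP; lia.
rewrite big1_fset ?addr0// => m; rewrite in_fsetD1 m0P => /andP[/negbTE -> _] _.
by [].
Qed.

(** [E = - C^2] is the projection onto the basis vectors at the finitely many
integers that the reflection [m |-> k - m] keeps on the same side of the origin.
There [pi P] is [(1 + V) / 2] on the even copy of l2(Z) and [(1 - V) / 2] on the
odd one, with [V] the reflection operator, so that the graded trace of [pi(P) E]
is the trace of [V E], the number of fixed points of the reflection: [k / 2] if
[k] is even, none otherwise. *)
Lemma w1_pairing_reflection : chern_pairing (w1 pi) P (~~ odd (absz k))%:R.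
Proof.
pose B := int_ball (absz k).
pose J : {fset int + int} := [fset i in map inl B ++ map inr B]%fset.
have big_J (f : int + int -> R[i]) :
    \sum_(i <- J) f i = \sum_(m <- B) (f (inl m) + f (inr m)).
  rewrite big_split /= -(big_map inl xpredT f) -(big_map inr xpredT f) -big_cat.
  apply: perm_big; apply: uniq_perm => [||i]; [exact: fset_uniq| |by rewrite in_fset].
  rewrite cat_uniq !map_inj_uniq ?fset_uniq// => [|? ? []//|? ? []//].
  rewrite andbT; apply/hasPn => _ /mapP[m _ ->]; apply/mapP => -[]. by [].
have := @chern_pairing_finite_rank R A (w1 pi) P w1_even
  (reflection_projection k) _ basis J basis_onb.
rewrite big_J (_ : - _ = (~~ odd (absz k))%:R).
  apply; first exact: C_fourth.
  move=> i iJ; have c_i n : (i == inl n) || (i == inr n) -> c n = 0.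
    move=> i_n; apply: c_outside; rewrite ltnNge -in_int_ball; apply: contra iJ => nB.
    rewrite in_fset mem_cat; case/orP: i_n => /eqP ->; last first.
      by rewrite [X in _ || X]map_f ?orbT.
    by rewrite map_f.
  apply: pair_ext => m; rewrite (CCE _ m).1 (CCE _ m).2.
  case: i iJ c_i => n _ c_n /=; rewrite mulr0; split=> //.
    by case: eqP => [->|_]; rewrite ?mulr0// c_n ?eqxx// mulr0 oppr0 mul0r.
  by case: eqP => [->|_]; rewrite ?mulr0// c_n ?eqxx ?orbT// mulr0 oppr0 mul0r.
rewrite -fixed_points -sumrN; apply: eq_bigr => m _; rewrite diagonal_inl diagonal_inr.
by case: eqP => [/c_half ->|_]; rewrite ?mulr1n ?mulr0n; field.
Qed.

End reflection.
End pairings.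

(** * Pullbacks and the theorem *)

Lemma pullback_fredholm (R : realType) (A B : cstarType R) (w : module_data B)
    (alpha : {lrmorphism A -> B}) :
  (forall a, alpha (star a) = star (alpha a)) ->
  even_fredholm_module w -> even_fredholm_module (pullback_module alpha w).
Proof.
move=> alpha_star [[pi_bounded pi_lin piM pi_star] wF w_compact w_gamma].
move=> [gamma_pi gammaF].
split; [split| |by move=> a; exact: w_compact| |by split=> // a x; exact: gamma_pi] => //.
- by move=> a; exact: pi_bounded.
- by move=> k a b x; rewrite /= linearP pi_lin.
- by move=> a b x; rewrite /= rmorphM piM.
- by move=> a x y; rewrite /= alpha_star pi_star.
Qed.

Lemma pullback_pairing (R : realType) (A B : cstarType R) (w : module_data B)
    (alpha : A -> B) (P : A) (z : R[i]) :
  projection P -> chern_pairing w (alpha P) z ->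
  chern_pairing (pullback_module alpha w) P z.
Proof. by move=> Pproj [_ pairing]; split. Qed.

Theorem proposition8 (R : realType) (A : cstarType R) (u : dihedral -> A)
  (A_group_cstar : is_group_cstar u)
  (S e : A) (S_def : S = u transl) (e_def : e = u refl)
  (phi : {lrmorphism A -> R[i]})
  (phi_star : forall a : A, phi (star a) = (phi a)^*%R)
  (phi_S : phi S = 1) (phi_e : phi e = 1)
  (pi1 : A -> hsum (l2Z R) (l2Z R) -> hsum (l2Z R) (l2Z R))
  (pi1_rep : star_representation pi1)
  (pi1_S : forall x, pi1 S x =
     block_op (@l2_shift R) (fun=> 0) (fun=> 0) (@l2_shift R) x)
  (pi1_e : forall x, pi1 e x =
     block_op (@l2_flip R) (fun=> 0) (fun=> 0) (fun y => - l2_flip y) x)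
  (alpha : {lrmorphism A -> A})
  (alpha_bij : bijective alpha)
  (alpha_star : forall a : A, alpha (star a) = star (alpha a))
  (alpha_S : alpha S = S) (alpha_e : alpha e = star S * e) :
  let W0 := w0 phi in
  let W1 := w1 pi1 in
  let W2 := pullback_module alpha W1 in
  let P := 2^-1 *: (1 + e) in
  let Q := 2^-1 *: (1 + S * e) in
  [/\ even_fredholm_module W0,
      even_fredholm_module W1 &
      even_fredholm_module W2] /\
  [/\ [/\ chern_pairing W0 1 1, chern_pairing W0 P 1 & chern_pairing W0 Q 1],
      [/\ chern_pairing W1 1 0, chern_pairing W1 P 1 & chern_pairing W1 Q 0] &
      [/\ chern_pairing W2 1 0, chern_pairing W2 P 0 & chern_pairing W2 Q 1]].
Proof.
move=> W0 W1 W2 P Q; subst S e.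
have QE : Q = 2^-1 *: (1 + u (1, true)) by rewrite /Q (group_mul A_group_cstar).
have P_proj : projection P := reflection_projection A_group_cstar 0.
have Q_proj : projection Q by rewrite QE; exact: (reflection_projection A_group_cstar).
have starS : star (u transl) = u (- 1, false).
  by have [_ uV _ _] := A_group_cstar; rewrite uV.
(* The automorphism translates the centre of every reflection by -1/2. *)
have alphaP : alpha P = 2^-1 *: (1 + u (- 1, true)).
  rewrite linearZ rmorphD rmorph1 /= alpha_e starS (group_mul A_group_cstar).
  by rewrite addr0.
have alphaQ : alpha Q = P.
  rewrite linearZ rmorphD rmorph1 /= rmorphM /= alpha_e alpha_S starS mulrA.
  by rewrite (group_mul A_group_cstar) /= subrr (group_one A_group_cstar) mul1r.
have W1_even := w1_fredholm A_group_cstar pi1_rep pi1_S pi1_e.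
have W1_reflection := w1_pairing_reflection A_group_cstar pi1_rep pi1_S pi1_e.
have W1_one := w1_pairing_one A_group_cstar pi1_rep pi1_S pi1_e.
have half_two : 2^-1 * (1 + 1) = 1 :> R[i] by field.
split; split.
- exact: w0_fredholm.
- exact: W1_even.
- exact: pullback_fredholm.
- split; apply: w0_pairing => //; first exact: projection1.
  + by rewrite rmorph1.
  + by rewrite linearZ rmorphD rmorph1 /= phi_e.
  + by rewrite linearZ rmorphD rmorph1 /= rmorphM /= phi_e phi_S mulr1.
- split; first exact: W1_one.
  + exact: (W1_reflection 0).
  + by rewrite QE; exact: (W1_reflection 1).
- have pull := @pullback_pairing R A A W1 alpha.
  split.
  + by apply: pull; [exact: projection1|rewrite rmorph1].
  + by apply: (pull _ _ P_proj); rewrite alphaP; exact: (W1_reflection (- 1)).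
  + by apply: (pull _ _ Q_proj); rewrite alphaQ; exact: (W1_reflection 0).
Qed.
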